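(* Let $X_t=mt+\sigma W_t+\sum_{i=1}^{N_t}U_i$, $t\ge0$, with exponentially distributed positive jumps $U_i$ of parameter $\eta_1>1$, and let $V=ve^X$, $v>0$. Assume $r>\psi(1)=m+\frac{\sigma^2}{2}+\frac{a}{\eta_1-1}$. Then: 1. The smallest optimal stopping time is $\tau^*(c)=\inf\{t\ge0:\ V_t\le B_c\}$, where $$B_c=\frac{c\bar\lambda(r-\psi(1))}{\alpha r(\bar\lambda+1)}.$$ 2. For $v>B_c$, the value function $w$ is equal to $$w(v)=\frac{\alpha v}{r-\psi(1)}-\frac cr+\frac{c}{r(1+\bar\lambda)}\left(\frac{B_c}{v}\right)^{\bar\lambda}.$$
   Context: $(W_t)_{t\ge0}$ is a standard Brownian motion, $(N_t)_{t\ge0}$ is a Poisson process with constant intensity $a>0$, $(U_i)$ is an i.i.d. sequence with density $\eta_1e^{-\eta_1y}\mathbf 1_{y>0}$, $\eta_1>1$; $W$, $N$ and $(U_i)$ are independent; $m\in\mathbb R$, $\sigma>0$. The constants satisfy $r>0,\alpha>0,c>0$. The number $\bar\lambda>0$ is such that $i\bar\lambda$ is the root with positive imaginary part of $r+\Psi(\lambda)=0$, where $\Psi(\lambda)=-im\lambda+\frac{\sigma^2\lambda^2}{2}-\frac{ai\lambda}{\eta_1-i\lambda}$ (so $\mathbb E(e^{i\lambda X_t})=e^{-t\Psi(\lambda)}$). $\mathcal F^V$ is the right-continuous complete filtration generated by $V$ and $\Delta$ is the set of $\mathcal F^V$-stopping times (possibly infinite). $\mathbb P_v,\mathbb E_v$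 denote probability and expectation given $V_0=v$. The optimal stopping problem and its value function are $$w(v)=\sup_{\tau\in\Delta}\mathbb E_v\left[\int_0^\tau e^{-rs}(\alpha V_s-c)\,ds\right].$$ A stopping time is optimal if it attains this supremum; the smallest optimal stopping time is the optimal $\tau^*$ with $\mathbb P_v(\tau^*\le\tau)=1$ for every optimal $\tau$. *)

(* Defs.v *)
From HB Require Import structures.
From mathcomp Require Import all_boot all_order all_algebra.
From mathcomp Require Import all_classical all_reals all_analysis.
From mathcomp Require Import complex.

Set Implicit Arguments.
Unset Strict Implicit.
Unset Printing Implicit Defensive.

Import Order.TTheory GRing.Theory Num.Theory.
Import numFieldNormedType.Exports.

Local Open Scope classical_set_scope.
Local Open Scope ring_scope.

(* Time-indexed families have index type R; only times t >= 0 are ever used,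
   and nothing is assumed about the values at negative times. *)

Section independence.
Context {d : measure_display} {T : measurableType d} {R : realType}.
Variable P : probability T R.

Definition mutually_independent (I : eqType) (F : I -> set_system T) :=
  forall (s : seq I) (A : I -> set T), uniq s ->
    (forall i, i \in s -> F i (A i)) ->
    P (\bigcap_(i in [set` s]) A i) = (\prod_(i <- s) P (A i))%E.

Definition independent_rvs (I : eqType) (X : I -> T -> R) :=
  mutually_independent
    (fun i => preimage_set_system setT (X i) (@measurable _ R)).

Definition independent_increments (X : R -> T -> R) :=
  forall t : nat -> R, 0 <= t 0%N -> nondecreasing_seq t ->
    independent_rvs (fun n w => X (t n.+1) w - X (t n) w).

End independence.

Definition sigma_process {d d' : measure_display} {T : measurableType d}
    {T' : measurableType d'} {I : Type} (D : set I) (X : I -> T -> T') :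
    set_system T :=
  <<s \bigcup_(i in D) preimage_set_system setT (X i) measurable >>.

Section driving_processes.
Context {d : measure_display} {T : measurableType d} {R : realType}.
Variable P : probability T R.

Definition brownian_motion (W : R -> {RV P >-> R}) :=
  [/\ {ae P, forall w, W 0 w = 0},
      {ae P, forall w, {within `[0, +oo[, continuous (fun t => W t w)}},
      independent_increments P (fun t w => W t w) &
      forall s t (B : set R), 0 <= s -> s < t -> measurable B ->
        P ((W t \- W s) @^-1` B) = normal_prob 0 (Num.sqrt (t - s)) B].

Definition poisson_process (a : R) (N : R -> {RV P >-> nat}) :=
  [/\ {ae P, forall w, N 0 w = 0%N},
      {ae P, forall w,
        (forall s t, 0 <= s -> s <= t -> (N s w <= N t w)%N) /\
        (forall t, 0 <= t ->
          (N u w)%:R @[u --> t^'+] --> ((N t w)%:R : R))},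
      independent_increments P (fun t w => (N t w)%:R) &
      forall s t (k : nat), 0 <= s -> s < t ->
        P [set w | N t w = (N s w + k)%N] =
          (poisson_pmf (a * (t - s)) k)%:E].

Definition iid_exponential (eta : R) (U : nat -> {RV P >-> R}) :=
  independent_rvs P (fun i w => U i w) /\
  forall i (B : set R), measurable B ->
    P (U i @^-1` B) = exponential_prob eta B.

Definition independent_WNU (W : R -> {RV P >-> R}) (N : R -> {RV P >-> nat})
    (U : nat -> {RV P >-> R}) :=
  mutually_independent P (fun k : 'I_3 =>
    tnth [tuple sigma_process [set t : R | 0 <= t] (fun t w => W t w);
                sigma_process [set t : R | 0 <= t] (fun t w => N t w);
                sigma_process [set: nat] (fun i w => U i w)] k).

(* The jumps U_1, U_2, ... are indexed from 0. *)
Definition jump_diffusion (m sigma : R) (W : R -> {RV P >-> R})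
    (N : R -> {RV P >-> nat}) (U : nat -> {RV P >-> R}) (t : R) (w : T) : R :=
  m * t + sigma * W t w + \sum_(i < N t w) U i w.

End driving_processes.

(* The law P_v is represented by keeping P fixed and starting V at v. *)
Definition exp_process {T : Type} {R : realType} (X : R -> T -> R) (v t : R)
    (w : T) : R :=
  v * expR (X t w).

(* The Laplace exponent of X at 1: E (e ^ X_t) = e ^ (t * psi1), and
   psi1 = - Psi (- i). *)
Definition psi1 {R : realType} (m sigma a eta1 : R) : R :=
  m + sigma ^+ 2 / 2 + a / (eta1 - 1).

(* The characteristic exponent of X: E (e ^ (i z X_t)) = e ^ (- t * Psi z). *)
Definition Psi {R : realType} (m sigma a eta1 : R) (z : R[i]) : R[i] :=
  let i : R[i] := 'i%C in
  - i * m%:C%C * z + (sigma%:C%C ^+ 2 * z ^+ 2) / 2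
  - (a%:C%C * i * z) / (eta1%:C%C - i * z).

Section stopping.
Context {d : measure_display} {T : measurableType d} {R : realType}.
Variable P : probability T R.

(* Right-continuous filtration generated by Y and the P-null sets. When P is
   complete, the P-negligible sets are exactly the measurable sets of measure
   zero. *)
Definition usual_filtration (Y : R -> T -> R) (t : R) : set_system T :=
  \bigcap_(u in [set u | t < u])
    <<s sigma_process `[0, u] Y `|` P.-negligible >>.

Definition stopping_time (F : R -> set_system T) (tau : T -> \bar R) :=
  (forall w, (0 <= tau w)%E) /\
  (forall t, 0 <= t -> F t [set w | (tau w <= t%:E)%E]).

Variables (r alpha c : R) (Y : R -> T -> R).

(* The inner set of times is [0, tau], understood as [0, +oo[ if tau = +oo. *)
Definition expected_gain (tau : T -> \bar R) : \bar R :=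
  (\int[P]_w \int[lebesgue_measure]_(s in [set s | (0 <= s)%R /\ s%:E <= tau w])
     (expR (- (r * s)) * (alpha * Y s w - c))%:E)%E.

Definition optimal_value : \bar R :=
  ereal_sup (expected_gain @` stopping_time (usual_filtration Y)).

Definition optimal (tau : T -> \bar R) :=
  stopping_time (usual_filtration Y) tau /\ expected_gain tau = optimal_value.

Definition smallest_optimal (tau : T -> \bar R) :=
  optimal tau /\
  forall tau', optimal tau' -> P [set w | (tau w <= tau' w)%E] = 1%E.

End stopping.

(* The infimum of the empty set is +oo. *)
Definition hitting_below {T : Type} {R : realType} (Y : R -> T -> R) (b : R)
    (w : T) : \bar R :=
  ereal_inf (EFin @` [set t | 0 <= t /\ Y t w <= b]).

Definition B_c {R : realType} (m sigma a eta1 r alpha c lambda : R) : R :=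
  c * lambda * (r - psi1 m sigma a eta1) / (alpha * r * (lambda + 1)).

(* Main.v *)
(** The process exp(th X_t - psi(th) t) is a martingale for every th < eta1, where psi is the
Laplace exponent of X, and psi(-lambda) = r. Integrating the running gain of V up to tau by
optional stopping turns the criterion into
  alpha v / q - c / r + E[e^(-r tau) h(V_tau); tau < oo],
with q = r - psi(1) and h(x) = c / r - alpha x / q. As X has no negative jumps, V equals z when
it first passes below a level z < v, so the martingale with exponent -lambda gives
E[e^(-r T_z)] = (z / v)^lambda; letting the levels decrease to B this also identifies, up to a
null set, the hitting time of [0, B] with the strict passage time below B. Optimality follows from
the elementary inequality lambda + 1 <= lambda u + u^(-lambda), with equality only at u = 1: it
bounds h(x) by C x^(-lambda) if v > B (by A + C x^(-lambda) if v <= B), and E[e^(-r tau) V_tau^(-lambda)]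
is at most v^(-lambda) for every tau. Equality forces V_tau = B almost surely on {tau < oo},
whence tau is at least the hitting time. *)

Require Import Defs.
From HB Require Import structures.
From mathcomp Require Import all_boot all_order all_algebra.
From mathcomp Require Import all_classical all_reals all_analysis.
From mathcomp Require Import complex.
From mathcomp Require Import measurable_realfun.
From mathcomp Require Import ring lra.

Set Implicit Arguments.
Unset Strict Implicit.
Unset Printing Implicit Defensive.

Import Order.TTheory GRing.Theory Num.Theory.
Import numFieldNormedType.Exports.

Local Open Scope classical_set_scope.
Local Open Scope ring_scope.

(** * Independence and integration *)

Section independence_of_set_systems.
Context {d : measure_display} {T : measurableType d} {R : realType}.
Variable P : probability T R.
Local Open Scope ereal_scope.

Definition indep_systems (G H : set_system T) :=
  forall A B, G A -> H B -> P (A `&` B) = P A * P B.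

Lemma indep_systemsC (G H : set_system T) :
  indep_systems G H -> indep_systems H G.
Proof. by move=> GH A B HA GB; rewrite setIC muleC; exact: GH. Qed.

Lemma g_sigma_subset (G : set_system T) :
  G `<=` measurable -> <<s G >> `<=` measurable.
Proof. exact: smallest_sub (@sigma_algebra_measurable _ T). Qed.

Lemma setI_closedT (G : set_system T) :
  setI_closed G -> setI_closed (G `|` [set setT]).
Proof.
move=> GI A B [GA|->] [GB|->]; rewrite ?setIT ?setTI; do ?by left.
  by left; exact: GI.
by right.
Qed.

Lemma indep_systems_sigmal (G H : set_system T) :
  G `<=` measurable -> H `<=` measurable -> setI_closed G ->
  indep_systems G H -> indep_systems <<s G >> H.
Proof.
move=> mG mH GI GH A B GA HB.
have mB := mH _ HB.
pose G' := G `|` [set setT].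
have mG' : G' `<=` measurable by move=> C [/mG//|->].
have GA' : <<s G' >> A by apply: sub_sigma_algebra2 GA => ? ?; left.
have PBge0 : (0 <= fine (P B))%R by rewrite fine_ge0.
have PBE : P B = (fine (P B))%:E by rewrite fineK// fin_num_measure.
have Tcov : \bigcup_(k : nat) [set: T] = setT by rewrite bigcup_const//; exists 0%N.
have := @g_sigma_algebra_measure_unique _ _ T G' mG' (fun=> setT)
  (fun=> or_intror erefl) Tcov
  (mrestr P mB) (mscale (NngNum PBge0) P).
move=> /(_ _ _ _ A GA') muniq.
have mE C : mscale (NngNum PBge0) P C = P B * P C by rewrite [in RHS]PBE.
rewrite -[LHS]/(mrestr P mB A) muniq; [by rewrite muleC; exact: mE|..].
- exact: setI_closedT.
- move=> C [GC|->]; apply: etrans (esym (mE _)); rewrite -[LHS]/(P (_ `&` _)).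
    by rewrite muleC GH.
  by rewrite setTI probability_setT mule1.
- move=> _; suff : P (setT `&` B) < +oo by [].
  by rewrite (le_lt_trans (probability_le1 _ _)) ?ltry// setTI.
Qed.

Lemma indep_systems_sigma (G H : set_system T) :
  G `<=` measurable -> H `<=` measurable -> setI_closed G -> setI_closed H ->
  indep_systems G H -> indep_systems <<s G >> <<s H >>.
Proof.
move=> mG mH GI HI GH; apply: indep_systems_sigmal => //.
  exact: g_sigma_subset.
by apply: indep_systemsC; apply: indep_systems_sigmal => //;
  exact: indep_systemsC.
Qed.

Lemma g_sigma_measurable_fun (G : set_system T) d' (T' : measurableType d')
    (f : T -> T') : G `<=` measurable ->
  measurable_fun setT (f : g_sigma_algebraType G -> T') -> measurable_fun setT f.
Proof.
by move=> mG mf _ B mB; apply: (g_sigma_subset mG); exact: mf.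
Qed.

Lemma indep_expectation (G H : set_system T) (f g : T -> R) :
  G `<=` measurable -> H `<=` measurable -> indep_systems <<s G >> <<s H >> ->
  measurable_fun setT (f : g_sigma_algebraType G -> R) ->
  measurable_fun setT (g : g_sigma_algebraType H -> R) ->
  (forall w, 0 <= f w)%R -> (forall w, 0 <= g w)%R ->
  \int[P]_w (f w * g w)%:E = \int[P]_w (f w)%:E * \int[P]_w (g w)%:E.
Proof.
move=> mG mH GH mf mg f0 g0.
have mf' := g_sigma_measurable_fun mG mf.
have mg' := g_sigma_measurable_fun mH mg.
pose F : {mfun T >-> R} := HB.pack f (isMeasurableFun.Build _ _ _ _ f mf').
pose K : {mfun T >-> R} := HB.pack g (isMeasurableFun.Build _ _ _ _ g mg').
have mh : measurable_fun setT (fun w => (f w, g w)).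
  exact: measurable_fun_pair.
pose h : {mfun T >-> (R * R)%type} :=
  HB.pack (fun w => (f w, g w)) (isMeasurableFun.Build _ _ _ _ _ mh).
pose k (z : R * R) : \bar R := (`|z.1| * `|z.2|)%:E.
have mk : measurable_fun [set: R * R] k.
  apply/measurable_EFinP; apply: measurable_funM; exact: measurableT_comp.
have k0 z : 0 <= k z by rewrite lee_fin mulr_ge0.
transitivity (\int[distribution P h]_z k z).
  rewrite ge0_integral_distribution//; apply: eq_integral => w _ /=.
  by rewrite /k /= !ger0_norm.
transitivity (\int[distribution P F \x distribution P K]_z k z).
  apply: eq_measure_integral => A mA _.
  symmetry; apply: product_measure_unique => // B C mB mC.
  change (P (f @^-1` B `&` g @^-1` C) = P (f @^-1` B) * P (g @^-1` C)).
  by apply: GH; rewrite -[X in <<s _ >> X]setTI; [exact: mf|exact: mg].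
have mnormE : measurable_fun setT (fun x : R => `|x|%:E).
  by apply/measurable_EFinP; exact: normr_measurable.
rewrite fubini_tonelli1//.
transitivity (\int[distribution P F]_x
    (`|x|%:E * \int[distribution P K]_y `|y|%:E)).
  apply: eq_integral => x _; rewrite /fubini_F -ge0_integralZl//.
rewrite ge0_integralZr//; last exact: integral_ge0.
rewrite !ge0_integral_distribution//=.
by congr (_ * _); apply: eq_integral => w _ /=; rewrite ger0_norm.
Qed.

End independence_of_set_systems.

Section density.
Context {d : measure_display} {T : measurableType d} {R : realType}.
Variables (mu nu : {measure set T -> \bar R}) (p : T -> R).
Hypothesis mp : measurable_fun setT p.
Hypothesis p0 : forall x, 0 <= p x.
Local Open Scope ereal_scope.
Hypothesis nuE : forall A, measurable A -> nu A = \int[mu]_(x in A) (p x)%:E.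

Import HBNNSimple.

Let integral_density_nnsfun (f : {nnsfun T >-> R}) :
  \int[nu]_x (f x)%:E = \int[mu]_x ((f x)%:E * (p x)%:E).
Proof.
under [LHS]eq_integral do rewrite fimfunE -fsumEFin//.
rewrite [LHS]ge0_integral_fsum//; last 2 first.
  - by move=> r; exact/measurable_EFinP/measurableT_comp.
  - by move=> n x _; rewrite EFinM nnfun_muleindic_ge0.
under [RHS]eq_integral.
  move=> x xD; rewrite muleC fimfunE -fsumEFin// ge0_mule_fsumr; last first.
    by move=> r; rewrite EFinM nnfun_muleindic_ge0.
  over.
rewrite [RHS]ge0_integral_fsum//; last 2 first.
  - move=> r; apply: emeasurable_funM; first exact/measurable_EFinP.
    by apply/measurable_EFinP; do 2 apply/measurableT_comp => //.
  - move=> n x _; rewrite mule_ge0 ?lee_fin//.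
    by have := nnfun_muleindic_ge0 f n x; rewrite -EFinM lee_fin.
apply: eq_fsbigr => r _.
have [r0|r0] := leP 0%R r; last first.
  rewrite (_ : f @^-1` [set r] = set0); last first.
    by apply/preimage10 => -[x _ fxr]; have : (0 <= f x)%R by []; rewrite fxr leNgt r0.
  by rewrite !integral0_eq// => x _; rewrite indic0 mulr0 ?mule0.
rewrite integralZl_indic_nnsfun// integral_indic// setIT nuE// integral_mkcond.
rewrite -ge0_integralZl//=; last 2 first.
  apply/(measurable_restrictT _ _).1 => //; apply: measurable_funTS.
  exact/measurable_EFinP.
  by move=> x _; apply: erestrict_ge0 => y _; rewrite lee_fin.
apply: eq_integral => x _; rewrite patchE indicE.
by case: ifPn => _; rewrite ?mulr1 ?mulr0 ?mule0// muleC.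
Qed.

Lemma ge0_integral_density (f : T -> \bar R) :
  measurable_fun setT f -> (forall x, 0 <= f x) ->
  \int[nu]_x f x = \int[mu]_x (f x * (p x)%:E).
Proof.
move=> mf f0.
pose f_ := nnsfun_approx measurableT mf.
transitivity (lim (\int[nu]_x (f_ n x)%:E @[n --> \oo])).
  rewrite -monotone_convergence//=.
  - apply: eq_integral => ? /[!inE] xD; apply/esym/cvg_lim => //=.
    exact: cvg_nnsfun_approx.
  - by move=> n; exact/measurable_EFinP/measurable_funTS.
  - by move=> n ? _; rewrite lee_fin.
  - by move=> ? _ ? ? mn; rewrite lee_fin; exact/lefP/nd_nnsfun_approx.
transitivity (lim (\int[mu]_x ((f_ n x)%:E * (p x)%:E) @[n --> \oo])).
  by apply: congr_lim; apply/funext => n /=; exact: integral_density_nnsfun.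
rewrite -monotone_convergence//=.
- apply: eq_integral => x _; apply/cvg_lim => //=; apply: cvgeZr => //.
  exact: cvg_nnsfun_approx.
- by move=> n; apply: emeasurable_funM; exact/measurable_EFinP.
- by move=> n x _; rewrite mule_ge0 ?lee_fin.
- move=> x _ a b ab; rewrite lee_wpmul2r ?lee_fin//.
  exact/lefP/nd_nnsfun_approx.
Qed.

End density.

Section laws.
Context {d : measure_display} {T : measurableType d} {R : realType}.
Variable P : probability T R.
Local Open Scope ereal_scope.
Notation mu := (@lebesgue_measure R).

Lemma ge0_expectation_density (X : {RV P >-> R}) (p : R -> R) (f : R -> \bar R) :
  measurable_fun setT p -> (forall x, 0 <= p x)%R ->
  (forall B, measurable B -> P (X @^-1` B) = \int[mu]_(x in B) (p x)%:E) ->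
  measurable_fun setT f -> (forall x, 0 <= f x) ->
  \int[P]_w f (X w) = \int[mu]_x (f x * (p x)%:E).
Proof.
move=> mp p0 PX mf f0.
have mX : measurable_fun [set: T] (X : T -> measurableTypeR R).
  exact: (@measurable_funPT _ _ _ _ X).
pose Y : {mfun T >-> measurableTypeR R} :=
  HB.pack (X : T -> measurableTypeR R) (isMeasurableFun.Build _ _ _ _ _ mX).
have h := @ge0_integral_density _ (measurableTypeR R) R mu (distribution P Y) p mp p0 PX f mf f0.
by rewrite -h (ge0_integral_distribution Y).
Qed.

Let measurable_mgf (c : R) : measurable_fun setT (fun x : R => (expR (c * x))%:E).
Proof.
by apply/measurable_EFinP; apply: measurableT_comp => //; exact: measurable_funM.
Qed.

Lemma normal_mgf (X : {RV P >-> R}) (s c : R) : (0 < s)%R ->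
  (forall B, measurable B -> P (X @^-1` B) = normal_prob 0 s B) ->
  \int[P]_w (expR (c * X w))%:E = (expR (c ^+ 2 * s ^+ 2 / 2))%:E.
Proof.
move=> s0 PX.
rewrite (ge0_expectation_density (f := fun x => (expR (c * x))%:E)
  (measurable_normal_pdf 0 s) (normal_pdf_ge0 0 s) PX)//.
transitivity (\int[mu]_x ((expR (c ^+ 2 * s ^+ 2 / 2))%:E *
                          (normal_pdf (c * s ^+ 2) s x)%:E)).
  apply: eq_integral => x _; rewrite -!EFinM; congr EFin.
  rewrite !normal_pdfE ?gt_eqF// /normal_fun mulrCA [RHS]mulrCA; congr (_ * _)%R.
  rewrite -!expRD; congr expR.
  by field; rewrite gt_eqF.
rewrite ge0_integralZl//.
- by rewrite integral_normal_pdf mule1.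
- by apply/measurable_EFinP; exact: measurable_normal_pdf.
- by move=> x _; rewrite lee_fin normal_pdf_ge0.
Qed.

Lemma exponential_mgf (X : {RV P >-> R}) (eta c : R) : (0 < eta)%R -> (c < eta)%R ->
  (forall B, measurable B -> P (X @^-1` B) = exponential_prob eta B) ->
  \int[P]_w (expR (c * X w))%:E = (eta / (eta - c))%:E.
Proof.
move=> eta0 ceta PX.
have etac : (0 < eta - c)%R by rewrite subr_gt0.
rewrite (ge0_expectation_density (f := fun x => (expR (c * x))%:E)
  (measurable_exponential_pdf eta) (exponential_pdf_ge0 (ltW eta0)) PX)//.
transitivity (\int[mu]_x ((eta / (eta - c))%:E *
                          (exponential_pdf (eta - c) x)%:E)).
  apply: eq_integral => x _; rewrite -!EFinM; congr EFin.
  have [x0|x0] := leP 0%R x; last by rewrite !lt0_exponential_pdf// !mulr0.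
  rewrite !exponential_pdfE// mulrCA [RHS]mulrA divfK ?gt_eqF//; congr (_ * _)%R.
  by rewrite -expRD; congr expR; ring.
rewrite ge0_integralZl//.
- by rewrite integral_exponential_pdf// mule1.
- by apply/measurable_EFinP; exact: measurable_exponential_pdf.
- by move=> x _; rewrite lee_fin exponential_pdf_ge0// ltW.
- by rewrite lee_fin divr_ge0// ltW.
Qed.

Lemma exponential_prob_neg (eta : R) : exponential_prob eta `]-oo, 0%R[ = 0.
Proof.
rewrite /exponential_prob integral0_eq// => x /=.
by rewrite in_itv/= => x0; rewrite lt0_exponential_pdf.
Qed.

Lemma poisson_pgf (l z : R) : (0 < l)%R -> (0 < z)%R ->
  \sum_(0 <= k <oo) ((z ^+ k)%:E * (poisson_pmf l k)%:E) = (expR (l * (z - 1)))%:E.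
Proof.
move=> l0 z0.
have lz0 : (0 < l * z)%R by rewrite mulr_gt0.
transitivity (\sum_(0 <= k <oo)
   ((expR (l * (z - 1)))%:E * (poisson_pmf (l * z) k)%:E)).
  apply: eq_eseriesr => k _; rewrite -!EFinM; congr EFin.
  rewrite /poisson_pmf l0 lz0 exprMn mulrBr mulr1 expRD !expRN.
  have e1 : expR l != 0%R by rewrite gt_eqF ?expR_gt0.
  have e2 : expR (l * z) != 0%R by rewrite gt_eqF ?expR_gt0.
  have e3 : (k`!%:R : R) != 0%R by rewrite pnatr_eq0 gtn_eqF ?fact_gt0.
  by field; rewrite e1 e2 e3.
rewrite nneseriesZl/=; last by move=> k _; rewrite lee_fin poisson_pmf_ge0.
rewrite nneseries_esumT; last by move=> k; rewrite lee_fin poisson_pmf_ge0.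
suff -> : \esum_(i in [set: nat]) (poisson_pmf (l * z) i)%:E = 1 by rewrite mule1.
rewrite -(@probability_setT _ _ _ (poisson_prob (l * z) 0)).
by rewrite -[RHS]/(if _ then _ else _) lz0.
Qed.

Lemma ge0_integral_partition (K : T -> nat) (f : T -> R) :
  measurable_fun setT K -> measurable_fun setT f -> (forall w, 0 <= f w)%R ->
  \int[P]_w (f w)%:E = \sum_(0 <= k <oo) \int[P]_w (f w * (K w == k)%:R)%:E.
Proof.
move=> mK mf f0.
have mKk k : measurable (K @^-1` [set k]).
  by rewrite -[X in measurable X]setTI; exact: mK.
have KT : \bigcup_k K @^-1` [set k] = setT.
  by apply/seteqP; split => // w _; exists (K w).
transitivity (\int[P]_(w in \bigcup_k K @^-1` [set k]) (f w)%:E); first by rewrite KT.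
rewrite ge0_integral_bigcup//.
- apply: eq_eseriesr => k _; rewrite integral_mkcond; apply: eq_integral => w _.
  rewrite patchE; case: ifPn; rewrite ?inE/=.
    by move=> /eqP ->; rewrite mulr1.
  by rewrite notin_setE/= => /eqP/negPf ->; rewrite mulr0.
- exact/measurable_EFinP/measurable_funTS.
- by move=> w _; rewrite lee_fin.
- by apply/trivIsetP => i j _ _ ij; apply/seteqP; split => // w /= [Ki Kj]; move: ij;
    rewrite -Ki -Kj eqxx.
Qed.

End laws.

Section uniform_integrability.
Context {d : measure_display} {T : measurableType d} {R : realType}.
Variable P : probability T R.
Local Open Scope ereal_scope.

Lemma cvg_EFin_comp (I : Type) (F : set_system I) (u : I -> R) (l : R) :
  Filter F -> u x @[x --> F] --> l -> (u x)%:E @[x --> F] --> l%:E.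
Proof. by move=> FF ul; apply: cvg_EFin => //; exact: nearW. Qed.

Lemma cvg_expRN_scale (del C : R) : (0 < del)%R ->
  (expR (- (n%:R * del)) * C)%R @[n --> \oo] --> 0%R.
Proof.
move=> del0; rewrite -[X in _ --> X](mul0r C).
apply: cvgM; last exact: cvg_cst.
apply: (@cvg_comp _ _ _ (fun n : nat => (n%:R * del)%R) (fun x : R => expR (- x))
  _ (pinfty_nbhs R) _); last exact: cvgr_expR.
apply: (@cvg_comp _ _ _ (fun n : nat => n%:R : R) (fun x : R => (x * del)%R)
  _ (pinfty_nbhs R) _); first exact: cvgr_idn.
exact: gt0_cvgMly.
Qed.

(* [Q] plays the part of a power [Z ^ (1 + del)] with bounded expectation. *)
Lemma expectation_lim_ui (Z Q : nat -> T -> R) (Zl : T -> R) (e0 C del : R) :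
  (0 < del)%R ->
  (forall n, measurable_fun setT (Z n)) -> (forall n, measurable_fun setT (Q n)) ->
  measurable_fun setT Zl ->
  (forall n w, 0 <= Z n w)%R -> (forall n w, 0 <= Q n w)%R ->
  (forall w, 0 <= Zl w)%R ->
  (forall w, Z ^~ w @ \oo --> Zl w) ->
  (forall n, \int[P]_w (Z n w)%:E = e0%:E) ->
  (forall n, \int[P]_w (Q n w)%:E <= C%:E) ->
  (forall n w (l : nat), Z n w <= Num.min (Z n w) (expR l%:R) +
                           expR (- (l%:R * del)) * Q n w)%R ->
  \int[P]_w (Zl w)%:E = e0%:E.
Proof.
move=> del0 mZ mQ mZl Z0 Q0 Zl0 ZZl ZE QC ZQ.
have mE (f : T -> R) : measurable_fun setT f -> measurable_fun setT (EFin \o f).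
  by move=> mf; exact/measurable_EFinP.
apply/eqP; rewrite eq_le; apply/andP; split.
  have := @fatou _ _ _ P setT measurableT (fun n => EFin \o Z n)
    (fun n => mE _ (mZ n)) (fun n x _ => Z0 n x).
  under eq_integral => w _.
    rewrite (_ : limn_einf _ = (Zl w)%:E); last first.
      by have [] := cvg_limn_einf_sup (cvg_EFin_comp _ (ZZl w)).
    over.
  move=> /le_trans; apply.
  rewrite (_ : (fun n => _) = fun=> e0%:E); last by apply/funext => n; rewrite -(ZE n).
  by have [-> _] := cvg_limn_einf_sup (cvg_cst e0%:E).
have lim0 : (\int[P]_w (Zl w)%:E + (expR (- (l%:R * del)) * C)%:E) @[l --> \oo]
    --> \int[P]_w (Zl w)%:E.
  rewrite -[X in _ --> X]adde0.
  apply: cvgeD; [exact: fin_num_adde_defl|exact: cvg_cst|].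
  by apply: cvg_EFin_comp; exact: cvg_expRN_scale.
rewrite -(cvg_lim _ lim0)//; apply: lime_ge; first by apply/cvg_ex; eexists; exact: lim0.
apply: nearW => l.
pose m n w := Num.min (Z n w) (expR l%:R).
have mm n : measurable_fun setT (m n) by exact: measurable_minr.
have m0 n w : (0 <= m n w)%R by rewrite le_min Z0 expR_ge0.
have step n : e0%:E <= \int[P]_w (m n w)%:E + (expR (- (l%:R * del)) * C)%:E.
  rewrite -(ZE n).
  apply: (@le_trans _ _ (\int[P]_w ((m n w)%:E + (expR (- (l%:R * del)) * Q n w)%:E))).
    apply: ge0_le_integral => //.
    - by move=> w _; rewrite lee_fin.
    - exact: mE.
    - by apply: emeasurable_funD; apply: mE => //; exact: measurable_funM.
    - by move=> w _; rewrite -EFinD lee_fin ZQ.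
  rewrite ge0_integralD//; first last.
  - by apply: mE => //; exact: measurable_funM.
  - by move=> w _; rewrite lee_fin mulr_ge0 ?expR_ge0.
  - exact: mE.
  - by move=> w _; rewrite lee_fin.
  rewrite leeD2l// EFinM.
  under eq_integral do rewrite EFinM.
  rewrite ge0_integralZl//; first by rewrite lee_wpmul2l ?lee_fin ?expR_ge0.
  - exact: mE.
  - by move=> w _; rewrite lee_fin.
have cm : \int[P]_w (m n w)%:E @[n --> \oo] --> \int[P]_w (Num.min (Zl w) (expR l%:R))%:E.
  have [||||_ _] := @dominated_convergence _ _ _ P setT measurableT
    (fun n => EFin \o m n) (fun w => (Num.min (Zl w) (expR l%:R))%:E)
    (cst (expR l%:R)%:E) (fun n => mE _ (mm n)) => //.
  - apply: mE; exact: measurable_minr.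
  - apply: aeW => w _; apply: cvg_EFin_comp; rewrite /m !minr_absE.
    under eq_fun do rewrite minr_absE.
    apply: cvgM; last exact: cvg_cst.
    apply: (@cvgB _ R^o); first by apply: (@cvgD _ R^o) => //; exact: cvg_cst.
    apply: (@cvg_norm _ R^o).
    by apply: (@cvgB _ R^o) => //; exact: cvg_cst.
  - exact: finite_measure_integrable_cst.
  - apply: aeW => w n _; rewrite /= ger0_norm// lee_fin.
    by rewrite ge_min lexx orbT.
apply: (@le_trans _ _ (\int[P]_w (Num.min (Zl w) (expR l%:R))%:E +
                       (expR (- (l%:R * del)) * C)%:E)).
  have cm' : \int[P]_w (m n w)%:E + (expR (- (l%:R * del)) * C)%:E @[n --> \oo] -->
      \int[P]_w (Num.min (Zl w) (expR l%:R))%:E + (expR (- (l%:R * del)) * C)%:E.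
    by apply: cvgeD => //; [exact: fin_num_adde_defl|exact: cvg_cst].
  rewrite -(cvg_lim _ cm')//; apply: lime_ge; first by apply/cvg_ex; eexists; exact: cm'.
  exact: nearW.
rewrite leeD2r//; apply: ge0_le_integral => //.
- by move=> w _; rewrite lee_fin le_min Zl0 expR_ge0.
- apply: mE; exact: measurable_minr.
- exact: mE.
- by move=> w _; rewrite lee_fin ge_min lexx.
Qed.

End uniform_integrability.

(** * Independence of past and future *)

Section processes.
Context {d : measure_display} {T : measurableType d} {R : realType}.
Variable P : probability T R.

Definition gen_process {d'} {T' : measurableType d'} {I : Type}
    (D : set I) (X : I -> T -> T') : set_system T :=
  \bigcup_(i in D) preimage_set_system setT (X i) measurable.

Definition cylinders {I : eqType} (D : set I) (X : I -> T -> R) : set_system T :=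
  [set A | exists (l : seq I) (B : I -> set R),
    [/\ uniq l, (forall i, i \in l -> D i), (forall i, measurable (B i)) &
        A = \bigcap_(i in [set` l]) X i @^-1` B i]].

Lemma eq_measure_ae (A B : set T) : measurable A -> measurable B ->
  {ae P, forall w, A w <-> B w} -> P A = P B.
Proof.
move=> mA mB AB; rewrite -[A]setIT -[B]setIT -!integral_indic//.
apply: ge0_ae_eq_integral => //; do ?by move=> w _; rewrite lee_fin.
- exact/measurable_EFinP/measurable_indic.
- exact/measurable_EFinP/measurable_indic.
apply: filterS AB => w /= AB _; rewrite !indicE; congr (_%:R%:E).
by congr (nat_of_bool _); apply/idP/idP => /set_mem/AB/mem_set.
Qed.

Lemma gen_process_measurable {d'} {T' : measurableType d'} {I : Type}
    (D : set I) (X : I -> T -> T') :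
  (forall i, measurable_fun setT (X i)) -> gen_process D X `<=` measurable.
Proof. by move=> mX A [i _ [B mB <-]]; exact: mX. Qed.

Lemma gen_process_preimage {d'} {T' : measurableType d'} {I : Type}
    (D : set I) (X : I -> T -> T') (i : I) (B : set T') :
  D i -> measurable B -> gen_process D X (X i @^-1` B).
Proof. by move=> Di mB; exists i => //; exists B => //; rewrite setTI. Qed.

Lemma gen_process_measurable_fun {d'} {T' : measurableType d'} {I : Type}
    (D : set I) (X : I -> T -> T') (i : I) (G : set_system T) : D i ->
  gen_process D X `<=` <<s G >> ->
  measurable_fun setT (X i : g_sigma_algebraType G -> T').
Proof.
by move=> Di XG _ B mB; rewrite setTI; apply: XG; exact: gen_process_preimage.
Qed.

Lemma cylinders_measurable (I : eqType) (D : set I) (X : I -> T -> R) :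
  (forall i, measurable_fun setT (X i)) -> cylinders D X `<=` measurable.
Proof.
move=> mX _ [l [B [_ _ mB ->]]]; apply: fin_bigcap_measurable.
  exact: finite_seq.
by move=> i _; rewrite -[X in measurable X]setTI; exact: mX.
Qed.

Lemma cylindersI (I : eqType) (D : set I) (X : I -> T -> R) :
  setI_closed (cylinders D X).
Proof.
move=> _ _ [l1 [B1 [u1 D1 m1 ->]]] [l2 [B2 [u2 D2 m2 ->]]].
exists (undup (l1 ++ l2)), (fun i => (if i \in l1 then B1 i else setT) `&`
                                     (if i \in l2 then B2 i else setT)).
split; first exact: undup_uniq.
- by move=> i; rewrite mem_undup mem_cat => /orP[/D1|/D2].
- by move=> i; apply: measurableI; case: ifP.
apply/seteqP; split => w /=.
  move=> [h1 h2] i /=; rewrite mem_undup mem_cat => il.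
  by split; [case: ifP => // /h1|case: ifP => // /h2].
move=> h; split => i /= il.
  by have [|+ _] := h i; rewrite ?il//= mem_undup mem_cat il.
by have [|_ +] := h i; rewrite ?il//= mem_undup mem_cat il orbT.
Qed.

Lemma gen_process_cylinders (I : eqType) (D : set I) (X : I -> T -> R) :
  gen_process D X `<=` cylinders D X.
Proof.
move=> _ [i Di [B mB <-]]; exists [:: i], (fun=> B); split => //.
  by move=> j; rewrite inE => /eqP ->.
rewrite setTI; apply/seteqP; split => [w Bw j /=|w]; last by apply => /=; rewrite inE.
by rewrite inE => /eqP ->.
Qed.

Lemma indep_rvs_split (X : nat -> T -> R) (n : nat) :
  (forall i, measurable_fun setT (X i)) -> independent_rvs P X ->
  indep_systems P (sigma_process [set i | (i < n)%N] X)
                  (sigma_process [set i | (n <= i)%N] X).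
Proof.
move=> mX iX.
suff h : indep_systems P <<s cylinders [set i | (i < n)%N] X >>
                         <<s cylinders [set i | (n <= i)%N] X >>.
  move=> A B GA HB; apply: h.
    by apply: sub_sigma_algebra2 GA; exact: gen_process_cylinders.
  by apply: sub_sigma_algebra2 HB; exact: gen_process_cylinders.
apply: indep_systems_sigma; [exact: cylinders_measurable|
  exact: cylinders_measurable|exact: cylindersI|exact: cylindersI|].
move=> _ _ [l1 [B1 [u1 D1 m1 ->]]] [l2 [B2 [u2 D2 m2 ->]]].
pose F i := X i @^-1` (if (i < n)%N then B1 i else B2 i).
have mF i : preimage_set_system setT (X i) measurable (F i).
  by exists (if (i < n)%N then B1 i else B2 i); rewrite ?setTI//; case: ifP.
have E1 : \bigcap_(i in [set` l1]) X i @^-1` B1 i = \bigcap_(i in [set` l1]) F i.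
  by apply: eq_bigcapr => i /D1 /= il; rewrite /F il.
have E2 : \bigcap_(i in [set` l2]) X i @^-1` B2 i = \bigcap_(i in [set` l2]) F i.
  by apply: eq_bigcapr => i /D2 /= il; rewrite /F ltnNge il.
have u12 : uniq (l1 ++ l2).
  rewrite cat_uniq u1 u2 andbT /=; apply/hasPn => i /D2 /= ni.
  by apply/negP => /D1 /=; rewrite ltnNge ni.
have E : (\bigcap_(i in [set` l1]) F i) `&` (\bigcap_(i in [set` l2]) F i) =
         \bigcap_(i in [set` l1 ++ l2]) F i.
  apply/seteqP; split => [w [h1 h2] i /=|w h].
    by rewrite mem_cat => /orP[/h1|/h2].
  by split => i /= il; apply: h; rewrite /= mem_cat il ?orbT.
by rewrite E1 E2 E !iX// big_cat.
Qed.

Lemma indep_increments_split (X : R -> T -> R) (s t : R) :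
  (forall u, measurable_fun setT (X u)) ->
  {ae P, forall w, X 0 w = 0} -> independent_increments P X ->
  0 <= s -> s <= t ->
  indep_systems P (sigma_process [set u | 0 <= u <= s] X)
    (preimage_set_system setT (fun w => X t w - X s w) measurable).
Proof.
move=> mX X0 iX s0 st.
suff h : indep_systems P (cylinders [set u | 0 <= u <= s] X)
    (preimage_set_system setT (fun w => X t w - X s w) measurable).
  have := indep_systems_sigmal (cylinders_measurable mX) _ (@cylindersI _ _ _) h.
  move=> h' A B GA HB; apply: h' => //.
    move=> _ [C mC <-]; apply: measurable_funB => //.
  by apply: sub_sigma_algebra2 GA; exact: gen_process_cylinders.
move=> _ _ [l [B [ul Dl mB ->]]] [C mC <-].
pose q : seq R := sort <=%R (0 :: s :: l).
have sq : sorted <=%R q by apply: sort_sorted; exact: le_total.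
have zq : size q = (size l).+2 by rewrite size_sort.
have memq u : (u \in q) = [|| u == 0, u == s | u \in l] by rewrite mem_sort !inE.
have q0s u : u \in q -> 0 <= u <= s.
  by rewrite memq => /or3P[/eqP ->|/eqP ->|/Dl//]; rewrite ?s0 ?lexx.
pose tt i := nth t q i.
pose K := (size l).+1.
have ttq i : (i <= K)%N -> tt i \in q by move=> iK; rewrite mem_nth// zq ltnS.
have ndq i j : (i <= j)%N -> (j <= K)%N -> tt i <= tt j.
  move=> ij jK; apply: (sorted_leq_nth le_trans le_refl) => //;
    rewrite inE zq ltnS//; exact: leq_trans jK.
have idx u : u \in q -> (index u q <= K)%N by rewrite -index_mem zq ltnS.
have tidx u : u \in q -> tt (index u q) = u by move=> uq; rewrite /tt nth_index.
have tt0 : tt 0%N = 0.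
  have z0 : 0 \in q by rewrite memq eqxx.
  apply/eqP; rewrite eq_le; have /andP[-> _] := q0s _ (ttq 0%N isT); rewrite andbT.
  by rewrite -[leRHS](tidx _ z0); apply: ndq => //; exact: idx.
have ttK : tt K = s.
  have zs : s \in q by rewrite memq eqxx orbT.
  apply/eqP; rewrite eq_le; have /andP[_ ->] := q0s _ (ttq K (leqnn _)) => /=.
  by rewrite -[leLHS](tidx _ zs); apply: ndq => //; exact: idx.
have tty i : (K < i)%N -> tt i = t by move=> iK; rewrite /tt nth_default// zq.
have ndtt : nondecreasing_seq tt.
  move=> i j ij; have [jK|jK] := leqP j K; first exact: ndq.
  rewrite (tty _ jK); have [iK|iK] := leqP i K; last by rewrite tty.
  by have /andP[_ /le_trans] := q0s _ (ttq _ iK); apply.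
pose D n w := X (tt n.+1) w - X (tt n) w.
have mD n : measurable_fun setT (D n) by exact: measurable_funB.
have iD : independent_rvs P D by apply: iX; rewrite ?tt0.
have XD n w : X (tt n) w = X 0 w + \sum_(i < n) D i w.
  elim: n => [|n IH]; first by rewrite big_ord0 addr0 tt0.
  by rewrite big_ord_recr/= addrA -IH addrC subrK.
have KD : (fun w => X t w - X s w) = D K.
  by apply/funext => w; rewrite /D ttK tty.
rewrite KD setTI.
have lq u : u \in l -> u \in q by move=> ul'; rewrite memq ul' !orbT.
pose A := \bigcap_(u in [set` l]) X u @^-1` B u.
pose A' := \bigcap_(u in [set` l])
   (fun w => \sum_(i < (index u q)) D i w) @^-1` (B u).
have A'G : sigma_process [set i | (i < K)%N] D A'.
  apply: (@fin_bigcap_measurable _ (g_sigma_algebraType (gen_process _ D))).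
    exact: finite_seq.
  move=> u /= /lq/idx uK; rewrite -[X in measurable X]setTI.
  have : measurable_fun setT ((fun w => \sum_(i < (index u q)) D i w)
    : g_sigma_algebraType (gen_process [set i | (i < K)%N] D) -> R).
    apply: measurable_sum => i.
    apply: (gen_process_measurable_fun (D := [set i | (i < K)%N])).
      exact: leq_trans uK.
    exact: sub_sigma_algebra.
  by apply.
have DC : sigma_process [set i | (K <= i)%N] D (D K @^-1` C).
  apply: sub_sigma_algebra; apply: gen_process_preimage => //=.
have mA : measurable A.
  apply: fin_bigcap_measurable; first exact: finite_seq.
  by move=> u _; rewrite -[X in measurable X]setTI; exact: mX.
have mA' : measurable A'.
  exact: (g_sigma_subset (gen_process_measurable mD)) A'G.
have mDC : measurable (D K @^-1` C) by rewrite -[X in measurable X]setTI; exact: mD.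
have AA' : {ae P, forall w, A w <-> A' w}.
  apply: filterS X0 => w Xw0.
  have e u : u \in l -> X u w = \sum_(i < (index u q)) D i w.
    by move=> /lq uq; rewrite -[in LHS](tidx _ uq) XD Xw0 add0r.
  by split => h u /= ul'; have := h _ ul'; rewrite /= e.
have -> : P A = P A' by exact: eq_measure_ae.
rewrite -(indep_rvs_split mD iD A'G DC); apply: eq_measure_ae.
- exact: measurableI.
- exact: measurableI.
- by apply: filterS AA' => w [h1 h2]; split => -[Aw Dw]; split => //; [exact: h1|exact: h2].
Qed.

End processes.

Section triples.
Context {d : measure_display} {T : measurableType d} {R : realType}.
Variable P : probability T R.
Local Open Scope ereal_scope.

Definition triple_system (F G H : set_system T) : set_system T :=
  [set A | exists C D E, [/\ F C, G D, H E & A = C `&` D `&` E]].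

Lemma g_sigmaI (G : set_system T) : setI_closed <<s G >>.
Proof.
by move=> A B GA GB; exact: (@measurableI _ (g_sigma_algebraType G)).
Qed.

Lemma preimage_setI_closed (f : T -> R) :
  setI_closed (preimage_set_system setT f measurable).
Proof.
move=> _ _ [A mA <-] [B mB <-]; exists (A `&` B); first exact: measurableI.
by rewrite preimage_setI setIACA setIid.
Qed.

Lemma triple_systemI (F G H : set_system T) :
  setI_closed F -> setI_closed G -> setI_closed H ->
  setI_closed (triple_system F G H).
Proof.
move=> FI GI HI _ _ [C [D [E [FC GD HE ->]]]] [C' [D' [E' [FC' GD' HE' ->]]]].
exists (C `&` C'), (D `&` D'), (E `&` E').
split; [exact: FI|exact: GI|exact: HI|].
by rewrite setIACA; congr (_ `&` _); rewrite setIACA.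
Qed.

Lemma triple_system_measurable (F G H : set_system T) :
  F `<=` measurable -> G `<=` measurable -> H `<=` measurable ->
  triple_system F G H `<=` measurable.
Proof.
move=> mF mG mH _ [C [D [E [FC GD HE ->]]]].
by apply: measurableI; [apply: measurableI; [exact: mF|exact: mG]|exact: mH].
Qed.

Lemma sub_triple_system (F G H : set_system T) : F setT -> G setT -> H setT ->
  [/\ F `<=` triple_system F G H, G `<=` triple_system F G H &
      H `<=` triple_system F G H].
Proof.
move=> FT GT HT; split=> A ?.
- by exists A, setT, setT; split => //; rewrite !setIT.
- by exists setT, A, setT; split => //; rewrite setTI setIT.
- by exists setT, setT, A; split => //; rewrite !setTI.
Qed.

Variables S1 S2 S3 : set_system T.
Hypothesis mS1 : S1 `<=` measurable.
Hypothesis mS2 : S2 `<=` measurable.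
Hypothesis mS3 : S3 `<=` measurable.
Hypothesis S1I : setI_closed S1.
Hypothesis S2I : setI_closed S2.
Hypothesis S3I : setI_closed S3.
Hypothesis S1T : S1 setT.
Hypothesis S2T : S2 setT.
Hypothesis S3T : S3 setT.
Hypothesis S123 : forall A B C, S1 A -> S2 B -> S3 C ->
  P (A `&` B `&` C) = P A * P B * P C.

Lemma indep_triple_systems (F1 F2 F3 G1 G2 G3 : set_system T) :
  F1 `<=` S1 -> F2 `<=` S2 -> F3 `<=` S3 ->
  G1 `<=` S1 -> G2 `<=` S2 -> G3 `<=` S3 ->
  indep_systems P F1 G1 -> indep_systems P F2 G2 -> indep_systems P F3 G3 ->
  indep_systems P (triple_system F1 F2 F3) (triple_system G1 G2 G3).
Proof.
move=> FS1 FS2 FS3 GS1 GS2 GS3 FG1 FG2 FG3 _ _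
  [C [D [E [FC FD FE ->]]]] [C' [D' [E' [GC GD GE ->]]]].
rewrite setIACA [X in X `&` _]setIACA S123.
- rewrite (FG1 _ _ FC GC) (FG2 _ _ FD GD) (FG3 _ _ FE GE).
  rewrite !S123//; [|exact: GS1|exact: GS2|exact: GS3|exact: FS1|exact: FS2|exact: FS3].
  by rewrite [X in X * _]muleACA [LHS]muleACA.
- by apply: S1I; [exact: FS1|exact: GS1].
- by apply: S2I; [exact: FS2|exact: GS2].
- by apply: S3I; [exact: FS3|exact: GS3].
Qed.

Lemma indep3_expectation (f g h : T -> R) :
  measurable_fun setT (f : g_sigma_algebraType S1 -> R) ->
  measurable_fun setT (g : g_sigma_algebraType S2 -> R) ->
  measurable_fun setT (h : g_sigma_algebraType S3 -> R) ->
  (forall w, 0 <= f w)%R -> (forall w, 0 <= g w)%R -> (forall w, 0 <= h w)%R ->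
  \int[P]_w (f w * (g w * h w))%:E =
  \int[P]_w (f w)%:E * (\int[P]_w (g w)%:E * \int[P]_w (h w)%:E).
Proof.
move=> mf mg mh f0 g0 h0.
pose S23 := triple_system [set setT] S2 S3.
have T1 : [set [set: T]] `<=` measurable by move=> _ ->.
have mS23 : S23 `<=` measurable by exact: triple_system_measurable.
have [_ s2 s3] := sub_triple_system (erefl : [set [set: T]] setT) S2T S3T.
have S23E B C : S2 B -> S3 C -> P (B `&` C) = P B * P C.
  move=> SB SC; have := S123 S1T SB SC.
  by rewrite setTI probability_setT mul1e.
have S1_23 : indep_systems P <<s S1 >> <<s S23 >>.
  apply: indep_systems_sigma => //.
    by apply: triple_systemI => // _ _ -> ->; rewrite setIT.
  move=> A _ SA [C [B [D [-> SB SD ->]]]].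
  by rewrite setTI setIA S123// -muleA S23E.
have S2_3 : indep_systems P <<s S2 >> <<s S3 >>.
  by apply: indep_systems_sigma.
have mg' : measurable_fun setT (g : g_sigma_algebraType S23 -> R).
  move=> _ B mB; apply: sub_sigma_algebra2 s2 _ _; exact: mg.
have mh' : measurable_fun setT (h : g_sigma_algebraType S23 -> R).
  move=> _ B mB; apply: sub_sigma_algebra2 s3 _ _; exact: mh.
rewrite (indep_expectation (f := f) (g := fun w => g w * h w)%R mS1 mS23 S1_23)//.
- by rewrite (indep_expectation mS2 mS3 S2_3).
- exact: (@measurable_funM _ (g_sigma_algebraType S23)).
- by move=> w; rewrite mulr_ge0.
Qed.

End triples.

(** * The exponential martingale *)

Lemma nneseriesZl_gt0 (R : realType) (x : \bar R) (f : nat -> \bar R) :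
  (0 <= x -> (forall k, 0 < f k) ->
   \sum_(0 <= k <oo) (x * f k) = x * \sum_(0 <= k <oo) f k)%E.
Proof.
case: x => [x||//] x0 f0; first by rewrite nneseriesZl// => k _; exact: ltW.
rewrite (eq_eseriesr (g := fun=> +oo%E)) => [|k _]; last by rewrite gt0_mulye.
have f1 : (0 < \sum_(0 <= k <oo) f k)%E.
  apply: lt_le_trans (nneseries_lim_ge 1%N _); first by rewrite big_nat1.
  by move=> k _ _; exact: ltW.
rewrite gt0_mulye//; apply/eqP; rewrite -leye_eq.
apply: le_trans (nneseries_lim_ge 1%N _) => //.
by rewrite big_nat1.
Qed.

Section model.
Context {d : measure_display} {T : measurableType d} {R : realType}.
Variable P : probability T R.
Variables (W : R -> {RV P >-> R}) (N : R -> {RV P >-> nat}) (U : nat -> {RV P >-> R}).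
Variables (m sigma a eta : R).
Hypotheses (a_gt0 : 0 < a) (eta_gt0 : 0 < eta).
Hypothesis P_complete : measure_is_complete P.
Hypothesis W_brownian : brownian_motion W.
Hypothesis N_poisson : poisson_process a N.
Hypothesis U_exponential : iid_exponential eta U.
Hypothesis WNU_independent : independent_WNU W N U.

Notation X := (jump_diffusion m sigma W N U).

Definition laplace_exponent (th : R) : R :=
  m * th + sigma ^+ 2 * th ^+ 2 / 2 + a * th / (eta - th).

Let NR (t : R) (w : T) : R := (N t w)%:R.

Let SW := sigma_process [set t : R | 0 <= t] (fun t w => W t w).
Let SN := sigma_process [set t : R | 0 <= t] (fun t w => N t w).
Let SU := sigma_process [set: nat] (fun i w => U i w).

Let mNR t : measurable_fun setT (NR t).
Proof. by apply: (@measurableT_comp _ _ _ _ _ _ (fun n : nat => n%:R : R)). Qed.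

Let mSW : SW `<=` measurable.
Proof. by apply: g_sigma_subset; apply: gen_process_measurable => t. Qed.

Let mSN : SN `<=` measurable.
Proof. by apply: g_sigma_subset; apply: gen_process_measurable => t. Qed.

Let mSU : SU `<=` measurable.
Proof. by apply: g_sigma_subset; apply: gen_process_measurable => t. Qed.

Let g_sigmaT (G : set_system T) : <<s G >> setT.
Proof. exact: (@measurableT _ (g_sigma_algebraType G)). Qed.

Let sgenW i : 0 <= i -> measurable_fun setT (W i : g_sigma_algebraType SW -> R).
Proof.
move=> i0; apply: (gen_process_measurable_fun (D := [set t : R | 0 <= t])
  (X := fun t w => W t w) i0) => A GA.
by do 2 apply: sub_sigma_algebra.
Qed.

Let sgenN i : 0 <= i -> measurable_fun setT (NR i : g_sigma_algebraType SN -> R).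
Proof.
move=> i0; apply: (@measurableT_comp _ _ _ _ _ _ (fun n : nat => n%:R : R)) => //.
apply: (gen_process_measurable_fun (D := [set t : R | 0 <= t])
  (X := fun t w => N t w) i0) => A GA.
by do 2 apply: sub_sigma_algebra.
Qed.

Let sgenU i : measurable_fun setT (U i : g_sigma_algebraType SU -> R).
Proof.
apply: (gen_process_measurable_fun (D := [set: nat])
  (X := fun t w => U t w) I) => A GA.
by do 2 apply: sub_sigma_algebra.
Qed.

Let SWNU A B C : SW A -> SN B -> SU C ->
  P (A `&` B `&` C) = (P A * P B * P C)%E.
Proof.
move=> SA SB SC.
pose i0 : 'I_3 := Ordinal (isT : (0 < 3)%N).
pose i1 : 'I_3 := Ordinal (isT : (1 < 3)%N).
pose i2 : 'I_3 := Ordinal (isT : (2 < 3)%N).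
have := @WNU_independent [:: i0; i1; i2] (tnth [tuple A; B; C]).
rewrite !big_cons big_nil mule1 muleA => <-//; last first.
  by move=> i; rewrite !inE => /or3P[] /eqP ->.
congr (P _); apply/seteqP; split=> [w [[Aw Bw] Cw] i /=|w h].
  by rewrite !inE => /or3P[] /eqP ->.
by split; [split|]; [exact: (h i0)|exact: (h i1)|exact: (h i2)].
Qed.

Let PW s := sigma_process [set u | 0 <= u <= s] (fun t w => W t w).
Let PN s := sigma_process [set u | 0 <= u <= s] NR.
Let PU n := sigma_process [set i | (i < n)%N] (fun i w => U i w).
Let FW s t := preimage_set_system setT (fun w => W t w - W s w) measurable.
Let FN s t := preimage_set_system setT (fun w => NR t w - NR s w) measurable.
Let FU n := sigma_process [set i | (n <= i)%N] (fun i w => U i w).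
Let past s n := triple_system (PW s) (PN s) (PU n).
Let future s t n := triple_system (FW s t) (FN s t) (FU n).

Let PW_SW s : PW s `<=` SW.
Proof.
apply: sub_sigma_algebra2 => A [u /= /andP[u0 _] GA].
by exists u.
Qed.

Let PN_SN s : PN s `<=` SN.
Proof.
apply: smallest_sub; first exact: smallest_sigma_algebra.
move=> A [u /= /andP[u0 _] [B mB <-]]; apply: sub_sigma_algebra; exists u => //.
exists ((fun n : nat => n%:R : R) @^-1` B) => //.
Qed.

Let PU_SU n : PU n `<=` SU.
Proof. by apply: sub_sigma_algebra2 => A [u _ GA]; exists u. Qed.

Let FU_SU n : FU n `<=` SU.
Proof. by apply: sub_sigma_algebra2 => A [u _ GA]; exists u. Qed.

Let sigma_id (G : set_system T) : <<s <<s G >> >> = <<s G >>.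
Proof. by apply: sigma_algebra_id; exact: smallest_sigma_algebra. Qed.

Let FW_SW s t : 0 <= s -> s <= t -> FW s t `<=` SW.
Proof.
move=> s0 st A [B mB <-].
have h : measurable_fun setT
    ((fun w => W t w - W s w) : g_sigma_algebraType SW -> R).
  by apply: (@measurable_funB _ (g_sigma_algebraType SW)); apply: sgenW => //;
    exact: le_trans st.
by have := h measurableT B mB; rewrite /measurable/= /SW sigma_id.
Qed.

Let FN_SN s t : 0 <= s -> s <= t -> FN s t `<=` SN.
Proof.
move=> s0 st A [B mB <-].
have h : measurable_fun setT
    ((fun w => NR t w - NR s w) : g_sigma_algebraType SN -> R).
  by apply: (@measurable_funB _ (g_sigma_algebraType SN)); apply: sgenN => //;
    exact: le_trans st.
by have := h measurableT B mB; rewrite /measurable/= /SN sigma_id.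
Qed.

Let NR0 : {ae P, forall w, NR 0 w = 0}.
Proof. by case: N_poisson => N0 _ _ _; apply: filterS N0 => w; rewrite /NR => ->. Qed.

Let indep_past_future s t n : 0 <= s -> s <= t ->
  indep_systems P <<s past s n >> <<s future s t n >>.
Proof.
move=> s0 st; have [W0 _ Winc _] := W_brownian; have [_ _ Ninc _] := N_poisson.
have [Uind _] := U_exponential.
have FWm := subset_trans (FW_SW s0 st) mSW.
have FNm := subset_trans (FN_SN s0 st) mSN.
apply: indep_systems_sigma.
- by apply: triple_system_measurable;
    [exact: subset_trans mSW|exact: subset_trans mSN|exact: subset_trans mSU].
- by apply: triple_system_measurable => //; exact: subset_trans mSU.
- by apply: triple_systemI; exact: g_sigmaI.
- by apply: triple_systemI;
    [exact: preimage_setI_closed|exact: preimage_setI_closed|exact: g_sigmaI].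
apply: (indep_triple_systems (S1 := SW) (S2 := SN) (S3 := SU)) => //; try exact: g_sigmaI.
- exact: FW_SW.
- exact: FN_SN.
- by apply: indep_increments_split => // u; exact: measurable_funPT.
- exact: indep_increments_split.
- by apply: indep_rvs_split => // i; exact: measurable_funPT.
Qed.

Let mUn n i : (i < n)%N -> measurable_fun setT (U i : g_sigma_algebraType (PU n) -> R).
Proof.
move=> i0; apply: (gen_process_measurable_fun (D := [set i | (i < n)%N])
  (X := fun t w => U t w) i0) => A GA.
by do 2 apply: sub_sigma_algebra.
Qed.

Lemma expectation_prod_expR_jumps (th : R) (n k : nat) : th < eta ->
  (\int[P]_w (\prod_(i < k) expR (th * U (n + i)%N w))%:E = ((eta / (eta - th)) ^+ k)%:E)%E.
Proof.
move=> the; have [Uind Uexp] := U_exponential.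
elim: k => [|k IH].
  by under eq_integral do rewrite big_ord0; rewrite integral_cst//= probability_setT mule1.
under eq_integral do rewrite big_ord_recr/=.
have mU i : measurable_fun setT (U i) by exact: measurable_funPT.
have mexp (G : set_system T) i : measurable_fun setT (U i : g_sigma_algebraType G -> R) ->
    measurable_fun setT ((fun w => expR (th * U i w)) : g_sigma_algebraType G -> R).
  move=> mUi; apply: (@measurableT_comp _ _ _ _ _ _ expR) => //.
  exact: (@measurable_funM _ (g_sigma_algebraType G)).
rewrite (indep_expectation (G := PU (n + k)) (H := FU (n + k))
  (f := fun w => \prod_(i < k) expR (th * U (n + i)%N w))
  (g := fun w => expR (th * U (n + k)%N w))).
- by rewrite IH (exponential_mgf eta_gt0 the)// ?exprSr ?EFinM//; exact: Uexp.
- exact: subset_trans mSU.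
- exact: subset_trans mSU.
- by rewrite /PU /FU !sigma_id; exact: indep_rvs_split.
- apply: (@measurable_prod _ (g_sigma_algebraType (PU (n + k)))) => i _.
  by apply: mexp; apply: mUn; rewrite ltn_add2l.
- apply: mexp.
  apply: (gen_process_measurable_fun (D := [set i | (n + k <= i)%N])
    (X := fun t w => U t w)) => [|A GA]; first exact: leqnn.
  by do 2 apply: sub_sigma_algebra.
- by move=> w; rewrite prodr_ge0// => i _; exact: expR_ge0.
- by move=> w; exact: expR_ge0.
Qed.

Let jumps n k (w : T) : R := \sum_(i < k) U (n + i)%N w.

Let expectation_future s t n k th : 0 <= s -> s < t -> th < eta ->
  (\int[P]_w (expR (th * (m * (t - s) + sigma * (W t w - W s w) + jumps n k w)) *
              \1_[set k%:R] (NR t w - NR s w))%:E =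
   (expR ((m * th + sigma ^+ 2 * th ^+ 2 / 2) * (t - s)))%:E *
   (((eta / (eta - th)) ^+ k)%:E * (poisson_pmf (a * (t - s)) k)%:E))%E.
Proof.
move=> s0 st the; have [_ _ _ Wlaw] := W_brownian; have [_ _ _ Nlaw] := N_poisson.
have mW : measurable_fun setT ((fun w => expR (th * sigma * (W t w - W s w)))
    : g_sigma_algebraType SW -> R).
  apply: (@measurableT_comp _ _ _ _ _ _ expR) => //.
  apply: (@measurable_funM _ (g_sigma_algebraType SW)) => //.
  by apply: (@measurable_funB _ (g_sigma_algebraType SW)); apply: sgenW => //;
    apply: le_trans (ltW st).
have mN : measurable_fun setT ((fun w => \1_[set k%:R] (NR t w - NR s w))
    : g_sigma_algebraType SN -> R).
  apply: (@measurableT_comp _ _ _ _ _ _ (\1_[set k%:R] : R -> R)).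
    exact: measurable_indic.
  by apply: (@measurable_funB _ (g_sigma_algebraType SN)); apply: sgenN => //;
    apply: le_trans (ltW st).
have mJ : measurable_fun setT ((fun w => \prod_(i < k) expR (th * U (n + i)%N w))
    : g_sigma_algebraType SU -> R).
  apply: (@measurable_prod _ (g_sigma_algebraType SU)) => i _.
  apply: (@measurableT_comp _ _ _ _ _ _ expR) => //.
  exact: (@measurable_funM _ (g_sigma_algebraType SU)).
transitivity (\int[P]_w ((expR (th * m * (t - s)))%:E *
   (expR (th * sigma * (W t w - W s w)) * (\1_[set k%:R] (NR t w - NR s w) *
    \prod_(i < k) expR (th * U (n + i)%N w)))%:E))%E.
  apply: eq_integral => w _; rewrite -EFinM; congr EFin.
  rewrite -expR_sum -mulr_sumr -/(jumps n k w).
  rewrite (_ : th * _ = th * m * (t - s) + th * sigma * (W t w - W s w) +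
    th * jumps n k w); last by ring.
  by rewrite !expRD; ring.
have mWm := g_sigma_measurable_fun mSW mW.
have mNm := g_sigma_measurable_fun mSN mN.
have mJm := g_sigma_measurable_fun mSU mJ.
rewrite ge0_integralZl//; last 2 first.
  by apply/measurable_EFinP; do 2 apply: measurable_funM => //.
  by move=> w _; rewrite lee_fin !mulr_ge0 ?expR_ge0 ?prodr_ge0// => i _; exact: expR_ge0.
rewrite (indep3_expectation mSW mSN mSU _ _ _ _ _ _ SWNU mW mN mJ) => //.
- rewrite (normal_mgf (X := (W t \- W s)%R) (s := Num.sqrt (t - s))).
  + rewrite expectation_prod_expR_jumps// muleA -EFinM -expRD sqr_sqrtr ?subr_ge0 ?ltW//.
    rewrite [X in (_ * X)%E]muleC; congr (_%:E * (_ * _))%E.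
      by congr expR; ring.
    rewrite -(Nlaw s t k s0 st).
    rewrite (eq_integral (fun w => (\1_[set w | N t w = (N s w + k)%N] w)%:E)); last first.
      move=> w _; rewrite !indicE; congr (_%:R%:E); congr (nat_of_bool _).
      apply/idP/idP => /set_mem h; apply/mem_set; move: h => /=.
        by move/eqP; rewrite subr_eq -natrD eqr_nat addnC => /eqP.
      by rewrite /NR => ->; rewrite natrD addrAC subrr add0r.
    rewrite integral_indic// ?setIT//.
    rewrite [X in measurable X](_ : _ = (fun w => NR t w - NR s w) @^-1` [set k%:R]).
      by rewrite -[X in measurable X]setTI; apply: measurable_funB.
    apply/seteqP; split => w /=.
      by rewrite /NR => ->; rewrite natrD addrAC subrr add0r.
    by move/eqP; rewrite subr_eq -natrD eqr_nat addnC => /eqP.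
  + by rewrite sqrtr_gt0 subr_gt0.
  + by move=> B mB; rewrite -Wlaw.
- exact: g_sigmaI.
- exact: g_sigmaI.
- exact: g_sigmaI.
- exact: g_sigmaT.
- exact: g_sigmaT.
- exact: g_sigmaT.
- by move=> w; rewrite prodr_ge0// => i _; exact: expR_ge0.
Qed.

Let frozen n u w : R :=
  m * u + sigma * W u w + \sum_(i < n) \1_`]i%:R, +oo[ (NR u w) * U i w.

Let jump_diffusion_frozen (n : nat) u w : (N u w <= n)%N -> X u w = frozen n u w.
Proof.
move=> Nun; rewrite /jump_diffusion /frozen; congr (_ + _).
rewrite (big_ord_widen _ (fun i => U i w) Nun) big_mkcond; apply: eq_bigr => i _ /=.
rewrite indicE mem_setE in_itv/= andbT /NR ltr_nat.
by case: ifP; rewrite ?mul1r ?mul0r.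
Qed.

Let past_sub s n : [/\ PW s `<=` <<s past s n >>, PN s `<=` <<s past s n >> &
  PU n `<=` <<s past s n >>].
Proof.
have [||| h1 h2 h3] := @sub_triple_system _ _ (PW s) (PN s) (PU n); try exact: g_sigmaT.
by split; [move=> A /h1|move=> A /h2|move=> A /h3]; exact: sub_sigma_algebra.
Qed.

Let past_NR s n u : 0 <= u <= s ->
  measurable_fun setT (NR u : g_sigma_algebraType (past s n) -> R).
Proof.
move=> us; apply: (gen_process_measurable_fun (D := [set u | 0 <= u <= s])) => // A GA.
by have [_ h _] := past_sub s n; apply: h; exact: sub_sigma_algebra.
Qed.

Let past_frozen s n u : 0 <= u <= s ->
  measurable_fun setT (frozen n u : g_sigma_algebraType (past s n) -> R).
Proof.
move=> us; have [hW hN hU] := past_sub s n.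
apply: (@measurable_funD _ (g_sigma_algebraType (past s n))).
  apply: (@measurable_funD _ (g_sigma_algebraType (past s n))) => //.
  apply: (@measurable_funM _ (g_sigma_algebraType (past s n))) => //.
  apply: (gen_process_measurable_fun (D := [set u | 0 <= u <= s])
    (X := fun u w => W u w)) => // A GA.
  by apply: hW; exact: sub_sigma_algebra.
apply: (@measurable_sum _ (g_sigma_algebraType (past s n))) => i.
apply: (@measurable_funM _ (g_sigma_algebraType (past s n))).
  apply: (@measurableT_comp _ _ _ _ _ _ (\1_`]i%:R, +oo[ : R -> R)).
    exact: measurable_indic.
  exact: past_NR.
apply: (gen_process_measurable_fun (D := [set i | (i < n)%N])
  (X := fun i w => U i w)) => //= A GA.
by apply: hU; exact: sub_sigma_algebra.
Qed.

Let future_sub s t n : [/\ FW s t `<=` <<s future s t n >>,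
  FN s t `<=` <<s future s t n >> & FU n `<=` <<s future s t n >>].
Proof.
have T1 (f : T -> R) : preimage_set_system setT f measurable setT.
  by exists setT => //; rewrite setTI.
have [||| h1 h2 h3] := @sub_triple_system _ _ (FW s t) (FN s t) (FU n).
- exact: T1.
- exact: T1.
- exact: g_sigmaT.
by split; [move=> A /h1|move=> A /h2|move=> A /h3]; exact: sub_sigma_algebra.
Qed.

Let measurable_future s t n k th : measurable_fun setT
  ((fun w => expR (th * (m * (t - s) + sigma * (W t w - W s w) + jumps n k w)) *
     \1_[set k%:R] (NR t w - NR s w)) : g_sigma_algebraType (future s t n) -> R).
Proof.
have [hW hN hU] := future_sub s t n; set G := future s t n.
apply: (@measurable_funM _ (g_sigma_algebraType G)); last first.
  apply: (@measurableT_comp _ _ _ _ _ _ (\1_[set k%:R] : R -> R)).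
    exact: measurable_indic.
  by move=> _ B mB; apply: hN; exists B.
apply: (@measurableT_comp _ _ _ _ _ _ expR) => //.
apply: (@measurable_funM _ (g_sigma_algebraType G)) => //.
apply: (@measurable_funD _ (g_sigma_algebraType G)).
  apply: (@measurable_funD _ (g_sigma_algebraType G)) => //.
  apply: (@measurable_funM _ (g_sigma_algebraType G)) => //.
  by move=> _ B mB; apply: hW; exists B.
apply: (@measurable_sum _ (g_sigma_algebraType G)) => i.
apply: (gen_process_measurable_fun (D := [set i | (n <= i)%N])
  (X := fun i w => U i w)) => [|A GA]; first exact: leq_addr.
by apply: hU; exact: sub_sigma_algebra.
Qed.

Let mpast s n : past s n `<=` measurable.
Proof.
by apply: triple_system_measurable;
  [exact: subset_trans mSW|exact: subset_trans mSN|exact: subset_trans mSU].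
Qed.

Lemma measurable_jump_diffusion t : measurable_fun setT (X t).
Proof.
move=> _ B mB; rewrite setTI.
pose F n w := m * t + sigma * W t w + \sum_(i < n) U i w.
have mF n : measurable_fun setT (F n).
  apply: measurable_funD; last exact: measurable_sum.
  by apply: measurable_funD => //; exact: measurable_funM.
have -> : X t @^-1` B = \bigcup_n (N t @^-1` [set n] `&` F n @^-1` B).
  apply/seteqP; split => [w XB|w [n _ [/= <-//]]].
  by exists (N t w).
apply: bigcup_measurable => n _; apply: measurableI.
  by rewrite -[X in measurable X]setTI; exact: (measurable_funPT (N t)).
by rewrite -[X in measurable X]setTI; exact: mF.
Qed.

(* Events decided by time [s]: on [N s = n] they agree, up to a null set, with an
   event generated by [W] and [N] up to time [s] and by the first [n] jumps. *)
Definition observable s : set_system T := [set A | measurable A /\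
  forall n, exists A', <<s past s n >> A' /\
    {ae P, forall w, N s w = n -> (A w <-> A' w)}].

Lemma observable_sigma_algebra s : sigma_algebra setT (observable s).
Proof.
split.
- split => // n; exists set0; split; first exact: sigma_algebra0.
  exact: aeW.
- move=> A [mA hA]; split; first exact: measurableD.
  move=> n; have [A' [pA' AA']] := hA n.
  exists (setT `\` A'); split; first exact: sigma_algebraCD.
  by apply: filterS AA' => w h /h AA' /=; split=> -[_ nA]; split => // /AA'.
- move=> A hA; split; first by apply: bigcup_measurable => k _; case: (hA k).
  move=> n; have /choice[A' hA'] : forall k, exists A', <<s past s n >> A' /\
      {ae P, forall w, N s w = n -> (A k w <-> A' w)}.
    by move=> k; case: (hA k).
  exists (\bigcup_k A' k); split.
    by apply: sigma_algebra_bigcup => k; case: (hA' k).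
  have : {ae P, forall w k, N s w = n -> (A k w <-> A' k w)}.
    by apply: ae_foralln => k; case: (hA' k).
  apply: filterS => w h Nn; split => -[k _ Ak]; exists k => //.
    exact: (h k Nn).1.
  exact: (h k Nn).2.
Qed.

Let ae_N_nondecreasing : {ae P, forall w s t, 0 <= s -> s <= t -> (N s w <= N t w)%N}.
Proof. by case: N_poisson => _ h _ _; apply: filterS h => w []. Qed.

Lemma observable_filtration v s :
  <<s sigma_process `[0, s] (exp_process X v) `|` P.-negligible >> `<=` observable s.
Proof.
apply: smallest_sub; first exact: observable_sigma_algebra.
move=> A [|nA]; last first.
  split; first exact: P_complete.
  move=> n; exists set0; split; first exact: sigma_algebra0.
  have : {ae P, forall w, ~ A w} by apply: negligibleS nA => w /= /contrapT.
  by apply: filterS => w.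
move: A; apply: smallest_sub; first exact: observable_sigma_algebra.
move=> A [u /=]; rewrite in_itv/= => us [B mB <-]; rewrite setTI.
have mexp d' (T' : measurableType d') (f : T' -> R) : measurable_fun setT f ->
    measurable_fun setT (fun w => v * expR (f w)).
  move=> mf; apply: measurable_funM => //; exact: measurableT_comp.
split.
  rewrite -[X in measurable X]setTI; apply: mexp => //.
  exact: measurable_jump_diffusion.
move=> n; exists ((fun w => v * expR (frozen n u w)) @^-1` B); split.
  have := mexp _ (g_sigma_algebraType (past s n)) _ (past_frozen us) measurableT B mB.
  by rewrite setTI.
apply: filterS ae_N_nondecreasing => w Nw Nsn.
rewrite /exp_process /= (@jump_diffusion_frozen n)// -Nsn.
by case/andP: us => u0 us; exact: Nw.
Qed.

Lemma exponential_martingale th s t A : th < eta -> 0 <= s -> s <= t ->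
  observable s A ->
  (\int[P]_w (expR (th * X t w) * \1_A w)%:E =
   (expR (laplace_exponent th * (t - s)))%:E * \int[P]_w (expR (th * X s w) * \1_A w)%:E)%E.
Proof.
move=> the s0; rewrite le_eqVlt => /orP[/eqP <-|st] [mA oA].
  by rewrite subrr mulr0 expR0 mul1e.
have mexpX u : measurable_fun setT (fun w => expR (th * X u w)).
  apply: measurableT_comp => //; apply: measurable_funM => //.
  exact: measurable_jump_diffusion.
have mf u : measurable_fun setT (fun w => expR (th * X u w) * \1_A w).
  by apply: measurable_funM => //; exact: measurable_indic.
have f0 u w : 0 <= expR (th * X u w) * \1_A w by rewrite mulr_ge0 ?expR_ge0.
have [A' hA'] := choice oA.
pose zeta n w := expR (th * frozen n s w) * (\1_(A' n) w * \1_[set n%:R] (NR s w)).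
have mzeta n : measurable_fun setT (zeta n : g_sigma_algebraType (past s n) -> R).
  apply: (@measurable_funM _ (g_sigma_algebraType (past s n))).
    apply: (@measurableT_comp _ _ _ _ _ _ expR) => //.
    apply: (@measurable_funM _ (g_sigma_algebraType (past s n))) => //.
    by apply: past_frozen; rewrite s0 lexx.
  apply: (@measurable_funM _ (g_sigma_algebraType (past s n))).
    by apply: measurable_indic; case: (hA' n).
  apply: (@measurableT_comp _ _ _ _ _ _ (\1_[set n%:R] : R -> R)).
    exact: measurable_indic.
  by apply: past_NR; rewrite s0 lexx.
have zeta0 n w : 0 <= zeta n w by rewrite !mulr_ge0 ?expR_ge0.
have mzeta' n := g_sigma_measurable_fun (@mpast s n) (mzeta n).
have indN (n k : nat) : (\1_[set n%:R] (k%:R : R) : R) = (k == n)%:R.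
  by rewrite indicE in_set1 eqr_nat.
have mNn u n : measurable_fun setT (fun w => (N u w == n)%:R : R).
  rewrite (_ : (fun w => _) = (fun w => \1_[set n%:R] (NR u w))); last first.
    by apply/funext => w; rewrite indN.
  by apply: measurableT_comp => //; exact: measurable_indic.
have zetaE n : (\int[P]_w (zeta n w)%:E =
    \int[P]_w (expR (th * X s w) * \1_A w * (N s w == n)%:R)%:E)%E.
  apply: ge0_ae_eq_integral => //; do ?by move=> w _; rewrite lee_fin ?mulr_ge0.
  - exact/measurable_EFinP.
  - by apply/measurable_EFinP; exact: measurable_funM.
  have [_ h] := hA' n; apply: filterS h => w h _; congr EFin.
  rewrite /zeta indN; have [Nn|] := eqVneq (N s w) n; last by rewrite !mulr0.
  rewrite !mulr1 (@jump_diffusion_frozen n) ?Nn// !indicE; congr (_ * _%:R).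
  by congr (nat_of_bool _); apply/idP/idP => /set_mem/(h Nn)/mem_set.
have zE : eta / (eta - th) - 1 = th / (eta - th).
  by field; rewrite subr_eq0 gt_eqF.
have z0 : 0 < eta / (eta - th) by rewrite divr_gt0// subr_gt0.
have stepE n : (\int[P]_w (expR (th * X t w) * \1_A w * (N s w == n)%:R)%:E =
    (expR (laplace_exponent th * (t - s)))%:E * \int[P]_w (zeta n w)%:E)%E.
  have mg : measurable_fun setT (fun w => expR (th * X t w) * \1_A w * (N s w == n)%:R).
    exact: measurable_funM.
  have g0 w : 0 <= expR (th * X t w) * \1_A w * (N s w == n)%:R by rewrite mulr_ge0.
  have mK : measurable_fun setT (fun w => (N t w - N s w)%N).
    by apply: measurable_fun_subn; exact: measurable_funPT.
  rewrite (ge0_integral_partition P mK mg g0).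
  pose F k w := expR (th * (m * (t - s) + sigma * (W t w - W s w) + jumps n k w)) *
              \1_[set k%:R] (NR t w - NR s w).
  have mF k : measurable_fun setT (F k : g_sigma_algebraType (future s t n) -> R).
    exact: measurable_future.
  have F0 k w : 0 <= F k w by rewrite mulr_ge0 ?expR_ge0.
  have mfut : future s t n `<=` measurable.
    apply: triple_system_measurable; last exact: subset_trans mSU.
      exact: subset_trans (FW_SW s0 (ltW st)) mSW.
    exact: subset_trans (FN_SN s0 (ltW st)) mSN.
  have mF' k := g_sigma_measurable_fun mfut (mF k).
  transitivity (\sum_(0 <= k <oo) (\int[P]_w (zeta n w)%:E *
      ((expR ((m * th + sigma ^+ 2 * th ^+ 2 / 2) * (t - s)))%:E *
     (((eta / (eta - th)) ^+ k)%:E * (poisson_pmf (a * (t - s)) k)%:E))))%E.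
    apply: eq_eseriesr => k _; rewrite -(expectation_future n k s0 st the).
    rewrite -(indep_expectation (@mpast s n) mfut (indep_past_future s0 (ltW st))
      (mzeta n) (mF k))//.
    apply: ge0_ae_eq_integral => //.
    - apply/measurable_EFinP; apply: measurable_funM => //.
      rewrite (_ : (fun w => _) = (fun j : nat => (j == k)%:R : R) \o
        (fun w => (N t w - N s w)%N))//.
      exact: measurableT_comp.
    - by apply/measurable_EFinP; exact: measurable_funM.
    - by move=> w _; rewrite lee_fin mulr_ge0.
    have [_ hn] := hA' n.
    apply: filterS2 hn ae_N_nondecreasing => w {}hn Nw _; congr EFin.
    have Nst := Nw s t s0 (ltW st).
    rewrite /zeta /F indN -natrB// indN.
    have [Nn|] := eqVneq (N s w) n; last by rewrite !(mulr0, mul0r).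
    have [Nk|] := eqVneq (N t w - N s w)%N k; last by rewrite !(mulr0, mul0r).
    rewrite !mulr1 [RHS]mulrAC -expRD; congr (expR _ * _).
      rewrite -mulrDr; congr (_ * _).
      have Ntw : N t w = (n + k)%N by rewrite -Nk -Nn subnKC.
      rewrite -(@jump_diffusion_frozen n s) ?Nn// /jump_diffusion Ntw Nn big_split_ord/=.
      by rewrite /jumps; ring.
    rewrite !indicE; congr (_%:R).
    by congr (nat_of_bool _); apply/idP/idP => /set_mem/(hn Nn)/mem_set.
  have at0 : 0 < a * (t - s) by rewrite mulr_gt0// subr_gt0.
  rewrite nneseriesZl_gt0.
  - rewrite nneseriesZl/=; last first.
      by move=> k _; rewrite -EFinM lee_fin mulr_ge0 ?poisson_pmf_ge0// exprn_ge0// ltW.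
    rewrite poisson_pgf// muleC -EFinM -expRD zE; congr (_%:E * _)%E; congr expR.
    by rewrite /laplace_exponent; ring.
  - by apply: integral_ge0 => w _; rewrite lee_fin.
  - move=> k; rewrite -!EFinM lte_fin !mulr_gt0 ?expR_gt0 ?exprn_gt0//.
    by rewrite /poisson_pmf at0 !mulr_gt0 ?expR_gt0 ?exprn_gt0// invr_gt0 ltr0n fact_gt0.
rewrite (ge0_integral_partition P (measurable_funPT (N s)) (mf t) (f0 t)).
rewrite (ge0_integral_partition P (measurable_funPT (N s)) (mf s) (f0 s)).
rewrite -nneseriesZl/=; last by move=> k _; apply: integral_ge0 => w _; rewrite lee_fin mulr_ge0.
by apply: eq_eseriesr => n _; rewrite stepE zetaE.
Qed.

End model.

(** * Optional stopping and the expected gain *)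

Section right_continuous_processes.
Context {R : realType}.

Definition grid (del t : R) : R := del * (Num.truncn (t / del)).+1%:R.

Lemma grid_gt del t : 0 < del -> t < grid del t.
Proof. by move=> del0; rewrite /grid -ltr_pdivrMl// mulrC truncnS_gt. Qed.

Lemma grid_le del t : 0 < del -> 0 <= t -> grid del t <= t + del.
Proof.
move=> del0 t0; rewrite /grid -natr1 mulrDr mulr1 lerD2r.
by rewrite mulrC -ler_pdivlMr// truncn_le divr_ge0// ltW.
Qed.

Lemma cvg_grid (S t : R) (f : R -> R) : 0 < S -> 0 <= t ->
  f u @[u --> t^'+] --> f t -> f (grid (S / n.+1%:R) t) @[n --> \oo] --> f t.
Proof.
move=> S0 t0 /cvg_at_rightP; apply; split.
  by move=> n; apply: grid_gt; rewrite divr_gt0.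
have cS : t + S / n.+1%:R @[n --> \oo] --> t.
  rewrite -[X in _ --> X]addr0; apply: (@cvgD _ R^o); first exact: cvg_cst.
  rewrite -[X in _ --> X](mulr0 S); apply: cvgM; first exact: cvg_cst.
  exact: cvg_harmonic.
apply: (squeeze_cvgr _ (cvg_cst t) cS); apply: nearW => n.
by rewrite ltW ?grid_gt ?grid_le// divr_gt0.
Qed.

Lemma measurable_truncn : measurable_fun setT (@Num.truncn R).
Proof.
have mle k : measurable [set x : R | (Num.truncn x <= k)%N].
  rewrite (_ : [set _ | _] = `]-oo, k.+1%:R[%classic); first exact: measurable_itv.
  by apply/seteqP; split => x; rewrite /= in_itv/= truncn_le_nat.
have mk k : measurable [set x : R | Num.truncn x = k].
  case: k => [|k].
    rewrite (_ : [set _ | _] = [set x | (Num.truncn x <= 0)%N])//.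
    by apply/seteqP; split => x /=; rewrite leqn0 => /eqP.
  rewrite (_ : [set _ | _] = [set x | (Num.truncn x <= k.+1)%N] `\`
     [set x | (Num.truncn x <= k)%N]); first exact: measurableD.
  apply/seteqP; split => x /=; first by move=> ->; rewrite ltnn.
  by move=> [h1 /negP]; rewrite -ltnNge => h2; apply/eqP; rewrite eqn_leq h1.
move=> _ B _; rewrite setTI.
rewrite (_ : _ @^-1` B = \bigcup_(k in B) [set x | Num.truncn x = k]).
  exact: bigcup_measurable.
apply/seteqP; split => [x Bx|x [k Bk xk]]; first by exists (Num.truncn x).
by move: xk Bk => /= <-.
Qed.

Lemma measurable_countable_choice d1 d2 (Z : measurableType d1) (Z' : measurableType d2)
    (K : Z -> nat) (F : nat -> Z -> Z') :
  measurable_fun setT K -> (forall k, measurable_fun setT (F k)) ->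
  measurable_fun setT (fun z => F (K z) z).
Proof.
move=> mK mF _ B mB; rewrite setTI.
rewrite (_ : _ @^-1` B = \bigcup_n (K @^-1` [set n] `&` F n @^-1` B)).
  apply: bigcup_measurable => n _; apply: measurableI.
    by rewrite -[X in measurable X]setTI; exact: mK.
  by rewrite -[X in measurable X]setTI; exact: mF.
apply/seteqP; split => [z Bz|z [n _ [/= <-//]]].
by exists (K z).
Qed.

Lemma measurable_right_continuous d (T : measurableType d) (H : R -> T -> R) :
  (forall t, measurable_fun setT (H t)) ->
  (forall t w, 0 <= t -> H u w @[u --> t^'+] --> H t w) ->
  measurable_fun setT (fun z : R * T => H (Num.max 0 z.1) z.2).
Proof.
move=> mH rcH.
apply: (@measurable_fun_cvg _ (R * T)%type R setT
  (fun n z => H (grid (1 / n.+1%:R) (Num.max 0 z.1)) z.2)).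
  move=> n.
  apply: (@measurable_countable_choice _ _ _ _
     (fun z : R * T => Num.truncn (Num.max 0 z.1 / (1 / n.+1%:R)))
     (fun k z => H (1 / n.+1%:R * k.+1%:R) z.2)).
    apply: measurableT_comp; first exact: measurable_truncn.
    by apply: measurable_funM => //; apply: measurable_maxr.
  by move=> k; apply: measurableT_comp.
move=> -[t w] _ /=.
have t0 : 0 <= Num.max 0 t by rewrite le_max lexx.
exact: (@cvg_grid 1 _ (fun u => H u w) ltr01 t0 (rcH _ w t0)).
Qed.

End right_continuous_processes.

Section optional_stopping.
Context {d : measure_display} {T : measurableType d} {R : realType}.
Variable P : probability T R.
Variables (Y : R -> T -> R) (psi : R -> R) (eta : R) (G : R -> set_system T).
Hypothesis mY : forall t, measurable_fun setT (Y t).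
Hypothesis rcY : forall t w, 0 <= t -> Y u w @[u --> t^'+] --> Y t w.
Hypothesis Y0 : forall w, Y 0 w = 0.
Hypothesis sG : forall t, sigma_algebra setT (G t).
Hypothesis ndG : forall s t, s <= t -> G s `<=` G t.
Hypothesis mG : forall t, G t `<=` measurable.
Hypothesis martY : forall th s t A, th < eta -> 0 <= s -> s <= t -> G s A ->
  (\int[P]_w (expR (th * Y t w) * \1_A w)%:E =
   (expR (psi th * (t - s)))%:E * \int[P]_w (expR (th * Y s w) * \1_A w)%:E)%E.

Definition optional_time (tau : T -> \bar R) :=
  (forall w, (0 <= tau w)%E) /\
  (forall t, 0 < t -> G t [set w | (tau w < t%:E)%E]).

Definition discounted th q (tau : T -> \bar R) (w : T) : R :=
  if tau w is t%:E then expR (th * Y t w - q * t) else 0.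

Lemma discounted_ge0 th q tau w : 0 <= discounted th q tau w.
Proof. by rewrite /discounted; case: (tau w) => // t; exact: expR_ge0. Qed.

Let GI t A B : G t A -> G t B -> G t (A `&` B).
Proof. by move=> GA GB; rewrite -(sigma_algebra_id (sG t)); apply: g_sigmaI;
  exact: sub_sigma_algebra. Qed.

Let GD t A B : G t A -> G t B -> G t (A `\` B).
Proof.
move=> GA GB; rewrite setDE; apply: GI => //.
by rewrite -setTD; have [_ + _] := sG t; apply.
Qed.

Let G0 t : G t set0. Proof. by case: (sG t). Qed.

Let GT t : G t setT.
Proof. by rewrite -(setD0 setT); have [g0 + _] := sG t; apply. Qed.

Lemma measurable_optional_time tau : optional_time tau -> measurable_fun setT tau.
Proof.
move=> [tau0 tauG]; apply: (measurability _ (ErealGenInftyO.measurableE R)).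
move=> _ [_ [r ->] <-]; rewrite setTI.
have [r0|r0] := ltP 0 r.
  rewrite (_ : _ @^-1` _ = [set w | (tau w < r%:E)%E]); first exact: (mG (tauG _ r0)).
  by apply/seteqP; split => w; rewrite /= in_itv.
rewrite (_ : _ @^-1` _ = set0)//; apply/seteqP; split => w //=.
by rewrite in_itv/= ltNge (le_trans _ (tau0 w))// lee_fin.
Qed.

Lemma expectation_expR th t : th < eta -> 0 <= t ->
  (\int[P]_w (expR (th * Y t w))%:E = (expR (psi th * t))%:E)%E.
Proof.
move=> the t0; have := martY the (lexx 0) t0 (GT 0).
under eq_integral do rewrite indicT mulr1.
move=> ->; rewrite subr0 (eq_integral (fun=> 1%E)) => [|w _]; last first.
  by rewrite Y0 mulr0 expR0 indicT mulr1.
by rewrite integral_cst//= mul1e probability_setT mule1.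
Qed.

Let mexpY th q t : measurable_fun setT (fun w => expR (th * Y t w - q * t)).
Proof.
by apply: measurableT_comp => //; apply: measurable_funB => //; exact: measurable_funM.
Qed.

Let rc_expY th q t w : 0 <= t ->
  expR (th * Y u w - q * u) @[u --> t^'+] --> expR (th * Y t w - q * t).
Proof.
move=> t0.
apply: (@cvg_comp _ _ _ (fun u => th * Y u w - q * u) expR _ (nbhs (th * Y t w - q * t))).
  apply: (@cvgB _ R^o); apply: (@cvgM R); try exact: cvg_cst.
    exact: rcY.
  by apply: cvg_at_right_filter; exact: cvg_id.
exact: continuous_expR.
Qed.

Lemma measurable_discounted th q tau : (forall w, (0 <= tau w)%E) ->
  measurable_fun setT tau -> measurable_fun setT (discounted th q tau).
Proof.
move=> tau0 mtau.
pose H t w := expR (th * Y t w - q * t).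
have mH : measurable_fun setT (fun z : R * T => H (Num.max 0 z.1) z.2).
  apply: measurable_right_continuous => [t|t w t0]; first exact: mexpY.
  exact: rc_expY.
rewrite (_ : discounted th q tau =
  (fun w => \1_[set x | (x < +oo)%E] (tau w) * H (Num.max 0 (fine (tau w))) w)).
  apply: measurable_funM.
    apply: measurableT_comp => //; apply: measurable_indic.
    rewrite (_ : [set x | _] = `]-oo, +oo%E[%classic); first exact: emeasurable_itv.
    by apply/seteqP; split => x; rewrite /= in_itv.
  apply: (measurableT_comp (g := fun w => (fine (tau w), w)) mH).
  apply: measurable_fun_pair => //; exact: measurableT_comp.
apply/funext => w; rewrite /discounted indicE; have := tau0 w.
case: (tau w) => [t| |] //=.
- by rewrite lee_fin => t0; rewrite (mem_set (ltry t : [set x | (x < +oo)%E] t%:E)) mul1r /H max_r.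
- by rewrite memNset /= ?mul0r// ltxx.
Qed.

(* Along the approximations of [tau] from the right by grid points the martingale identity
   holds cell by cell; [p > 1] provides uniform integrability for the limit. *)
Lemma optional_stopping th p S tau : th < eta -> 1 < p -> p * th < eta -> 0 < S ->
  optional_time tau ->
  (\int[P]_w (expR (th * Y S w) * \1_[set w | (tau w < S%:E)%E] w)%:E =
   (expR (psi th * S))%:E *
   \int[P]_w (discounted th (psi th) tau w * \1_[set w | (tau w < S%:E)%E] w)%:E)%E.
Proof.
move=> the p1 pthe S0 otau; have [tau0 tauG] := otau.
have mtau := measurable_optional_time otau.
set B := [set w | (tau w < S%:E)%E].
have mB : measurable B by exact: (mG (tauG _ S0)).
have mBi : measurable_fun setT (\1_B : T -> R) by exact: measurable_indic.
pose del (n : nat) := S / n.+1%:R.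
have del0 n : 0 < del n by rewrite divr_gt0.
pose J n w := Num.truncn (fine (tau w) / del n).
have mJ n : measurable_fun setT (J n).
  apply: measurableT_comp; first exact: measurable_truncn.
  by apply: measurable_funM => //; exact: measurableT_comp.
pose t_ n k := del n * k.+1%:R.
have t_ge0 n k : 0 <= t_ n k by rewrite mulr_ge0// ltW.
have t_le n k : (k <= n)%N -> t_ n k <= S.
  move=> kn; rewrite /t_ /del -mulrA ger_pMr// mulrC ler_pdivrMr// mul1r.
  by rewrite ler_nat.
have cell n k : (k <= n)%N -> G (t_ n k) (B `&` [set w | J n w = k]).
  move=> kn.
  have E : B `&` [set w | J n w = k] = [set w | (tau w < (t_ n k)%:E)%E] `\`
      [set w | (tau w < (del n * k%:R)%:E)%E].
    apply/seteqP; split => w; rewrite /B /J /=; have := tau0 w;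
        case: (tau w) => [t| |] //=; rewrite ?lee_fin ?lte_fin => t0.
    - have td0 : 0 <= t / del n by rewrite divr_ge0// ltW.
      move=> [tS /eqP]; rewrite truncn_eq// => /andP[h1 h2].
      split; first by rewrite /t_ -ltr_pdivrMl// mulrC.
      by apply/negP; rewrite -leNgt -ler_pdivlMl// mulrC.
    - by rewrite ltNge leey/= => -[].
    - have td0 : 0 <= t / del n by rewrite divr_ge0// ltW.
      move=> [tt /negP]; rewrite -leNgt => kt.
      split; first by rewrite (lt_le_trans tt)// t_le.
      apply/eqP; rewrite truncn_eq//; apply/andP; split.
        by rewrite mulrC ler_pdivlMl.
      by rewrite mulrC ltr_pdivrMl.
    - by rewrite ltNge leey/= => -[].
  rewrite {}E; apply: GD; first by apply: tauG; rewrite mulr_gt0.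
  case: k kn => [|k] kn.
    rewrite (_ : [set _ | _] = set0)//; apply/seteqP; split => w //=.
    by rewrite mulr0 ltNge tau0.
  apply: (ndG (s := del n * k.+1%:R)); first by rewrite ler_pM2l// ler_nat.
  by apply: tauG; rewrite mulr_gt0.
have cell0 n k : (n < k)%N -> B `&` [set w | J n w = k] = set0.
  move=> nk; apply/seteqP; split => w //; rewrite /B /J /=; have := tau0 w.
  case: (tau w) => [t| |] //=; rewrite ?lee_fin ?lte_fin => t0; last first.
    by rewrite ltNge leey/= => -[].
  have td0 : 0 <= t / del n by rewrite divr_ge0// ltW.
  move=> [tS /eqP]; rewrite truncn_eq// => /andP[h1 h2].
  suff : (t < t)%R by rewrite ltxx.
  apply: lt_le_trans tS _; rewrite -(ler_pM2r (_ : 0 < (del n)^-1)) ?invr_gt0//.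
  apply: le_trans h1; rewrite /del invf_div mulrC -mulrA mulVf ?gt_eqF// mulr1.
  by rewrite ler_nat.
pose Z c n w := expR (c * th * Y (t_ n (J n w)) w - c * psi th * t_ n (J n w)) * \1_B w.
have mZ c n : measurable_fun setT (Z c n).
  apply: measurable_funM => //.
  apply: (@measurable_countable_choice _ _ _ _ (J n)
    (fun k w => expR (c * th * Y (t_ n k) w - c * psi th * t_ n k))).
    exact: mJ.
  by move=> k; exact: mexpY.
have Z0 c n w : 0 <= Z c n w by rewrite mulr_ge0 ?expR_ge0.
have BJ n k w : \1_B w * (J n w == k)%:R = \1_(B `&` [set w | J n w = k]) w :> R.
  rewrite indicI /= [X in _ = _ * X]indicE; congr (_ * _%:R); congr (nat_of_bool _).
  by apply/eqP/idP => [h|/set_mem//]; apply/mem_set.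
pose M c w := expR (c * th * Y S w) * \1_B w.
have mM c : measurable_fun setT (M c).
  apply: measurable_funM => //; apply: measurableT_comp => //; exact: measurable_funM.
have M0 c w : 0 <= M c w by rewrite mulr_ge0 ?expR_ge0.
have Zcell c n k : c * th < eta -> (k <= n)%N ->
    (\int[P]_w (Z c n w * (J n w == k)%:R)%:E =
     (expR (- (c * psi th * t_ n k) - psi (c * th) * (S - t_ n k)))%:E *
     \int[P]_w (M c w * (J n w == k)%:R)%:E)%E.
  move=> cth kn.
  under [in RHS]eq_integral do rewrite /M -mulrA BJ.
  rewrite (martY cth (t_ge0 n k) (t_le _ _ kn) (cell _ _ kn)) muleA -EFinM -expRD.
  rewrite subrK -ge0_integralZl//=; last first.
    apply/measurable_EFinP; apply: measurable_funM.
      by apply: measurableT_comp => //; exact: measurable_funM.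
    by apply: measurable_indic; exact: (mG (cell _ _ kn)).
  apply: eq_integral => w _; rewrite -EFinM; congr EFin; rewrite /Z -mulrA BJ.
  rewrite [RHS]mulrA -expRD.
  have [Jk|Jk] := pselect (J n w = k).
    by rewrite Jk; congr (expR _ * _); ring.
  by rewrite indicE memNset ?mulr0// => -[].
have cell00 n k : (n < k)%N -> forall f : T -> R,
    (\int[P]_w (f w * \1_B w * (J n w == k)%:R)%:E = 0)%E.
  move=> nk f; rewrite integral0_eq// => w _.
  by rewrite -mulrA BJ cell0// indic0 mulr0.
have Mle c : c * th < eta -> (\int[P]_w (M c w)%:E <= (expR (psi (c * th) * S))%:E)%E.
  move=> cth; rewrite -(expectation_expR cth (ltW S0)); apply: ge0_le_integral => //.
  - by move=> w _; rewrite lee_fin.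
  - exact/measurable_EFinP.
  - apply/measurable_EFinP; apply: measurableT_comp => //; exact: measurable_funM.
  - move=> w _; rewrite lee_fin /M ler_piMr ?expR_ge0// indicE; by case: (_ \in _).
have mJk n k : measurable_fun setT (fun w => (J n w == k)%:R : R).
  rewrite (_ : (fun w => _) = (fun j : nat => (j == k)%:R : R) \o J n)//.
  exact: measurableT_comp.
have IM c n k : (0 <= \int[P]_w (M c w * (J n w == k)%:R)%:E)%E.
  by apply: integral_ge0 => w _; rewrite lee_fin mulr_ge0.
have ZE n : (\int[P]_w (Z 1 n w)%:E = (expR (- (psi th * S)))%:E * \int[P]_w (M 1 w)%:E)%E.
  rewrite (ge0_integral_partition P (mJ n) (mZ 1 n) (Z0 1 n)).
  rewrite (ge0_integral_partition P (mJ n) (mM 1) (M0 1)) -nneseriesZl//.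
  apply: eq_eseriesr => k _; have [kn|nk] := leqP k n.
    rewrite Zcell// ?mul1r//; congr (_%:E * _)%E; congr expR; ring.
  by rewrite !cell00// mule0.
pose K := (`|p * psi th| + `|psi (p * th)|) * S.
have QE n : (\int[P]_w (Z p n w)%:E <= (expR (K + psi (p * th) * S))%:E)%E.
  apply: (@le_trans _ _ ((expR K)%:E * \int[P]_w (M p w)%:E)%E); last first.
    by rewrite expRD EFinM lee_wpmul2l ?lee_fin ?expR_ge0// Mle.
  rewrite (ge0_integral_partition P (mJ n) (mZ p n) (Z0 p n)).
  rewrite (ge0_integral_partition P (mJ n) (mM p) (M0 p)) -nneseriesZl//.
  apply: lee_nneseries => k _.
    by move=> _; apply: integral_ge0 => w _; rewrite lee_fin mulr_ge0.
  have [kn|nk] := leqP k n; last by rewrite !cell00// mule0.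
  rewrite Zcell// lee_wpmul2r// lee_fin ler_expR /K mulrDl.
  have t1 := t_le _ _ kn; have t0 := t_ge0 n k.
  apply: lerD.
    rewrite -mulNr; apply: le_trans (ler_norm _) _.
    by rewrite normrM normrN (ger0_norm t0) ler_wpM2l.
  rewrite -mulNr; apply: le_trans (ler_norm _) _.
  rewrite normrM normrN ler_wpM2l// ger0_norm ?subr_ge0//.
  by rewrite lerBlDr lerDl.
have M1fin : (\int[P]_w (M 1 w)%:E \is a fin_num)%E.
  rewrite ge0_fin_numE; last by apply: integral_ge0 => w _; rewrite lee_fin.
  by apply: le_lt_trans (Mle 1 _) _; rewrite ?mul1r ?ltry.
have := @expectation_lim_ui _ _ _ P (Z 1) (Z p)
  (fun w => discounted th (psi th) tau w * \1_B w)
  (expR (- (psi th * S)) * fine (\int[P]_w (M 1 w)%:E))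
  (expR (K + psi (p * th) * S)) (p - 1).
move=> ->.
- rewrite (EFinM _ (fine _)) (fineK M1fin) muleA -EFinM -expRD addrN expR0 mul1e.
  by apply: eq_integral => w _; rewrite /M mul1r.
- by rewrite subr_gt0.
- exact: mZ.
- exact: mZ.
- by apply: measurable_funM => //; exact: measurable_discounted.
- exact: Z0.
- exact: Z0.
- by move=> w; rewrite mulr_ge0// discounted_ge0.
- move=> w; rewrite /Z /discounted /J; have := tau0 w.
  rewrite indicE; have [/set_mem|] := boolP (w \in B); last first.
    by move=> _ _; under eq_fun do rewrite mulr0; rewrite mulr0; exact: cvg_cst.
  rewrite /B /=; case: (tau w) => [t| |] //= _; rewrite lee_fin => t0; rewrite mulr1.
  have h := @cvg_grid _ S t (fun u => expR (th * Y u w - psi th * u)) S0 t0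
    (@rc_expY th (psi th) t w t0).
  apply: cvg_trans h; apply: near_eq_cvg; apply: nearW => n.
  by rewrite mulr1 !mul1r.
- by move=> n; rewrite ZE EFinM fineK.
- exact: QE.
- move=> n w l; rewrite /Z indicE; case: (w \in B); rewrite ?mulr0 ?mulr1; last first.
    by rewrite addr0 le_min lexx expR_ge0.
  set y := 1 * th * _ - _.
  rewrite (_ : p * th * _ - _ = p * y); last by rewrite /y; ring.
  rewrite -expRD; have [yl|ly] := leP y l%:R.
    by rewrite min_l ?ler_expR// lerDl expR_ge0.
  apply: (@le_trans _ _ (expR (- (l%:R * (p - 1)) + p * y))).
    rewrite ler_expR -subr_ge0 (_ : _ - _ = (p - 1) * (y - l%:R)); last by ring.
    by rewrite mulr_ge0 ?subr_ge0// ltW.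
  by rewrite lerDr le_min !expR_ge0.
Qed.

Notation mu := (@lebesgue_measure R).

Let mlt tau (S : R) : optional_time tau -> measurable [set w | (tau w < S%:E)%E].
Proof.
move=> otau; have := emeasurable_fun_infty_o measurableT (measurable_optional_time otau) S%:E.
by rewrite setTI.
Qed.

Lemma cvg_discounted_before th q tau : optional_time tau ->
  ((\int[P]_w (discounted th q tau w * \1_[set w | (tau w < n.+1%:R%:E)%E] w)%:E
     @[n --> \oo]) --> \int[P]_w (discounted th q tau w)%:E)%E.
Proof.
move=> otau; have [tau0 _] := otau.
pose g n w : \bar R := (discounted th q tau w * \1_[set w | (tau w < n.+1%:R%:E)%E] w)%:E.
have ndg w : {homo (fun n => g n w) : i j / (i <= j)%N >-> (i <= j)%E}.
  move=> i j ij; rewrite /g lee_fin ler_wpM2l ?discounted_ge0// !indicE ler_nat.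
  have [/set_mem /= h|] := boolP (w \in [set w | (tau w < i.+1%:R%:E)%E]); last by case: (_ \in _).
  by rewrite mem_set//= (lt_le_trans h)// lee_fin ler_nat.
rewrite (_ : \int[P]_w (discounted th q tau w)%:E = \int[P]_w (limn (fun n => g n w)))%E.
  apply: (cvg_monotone_convergence (mu := P) measurableT).
  - move=> n; apply/measurable_EFinP; apply: measurable_funM; last first.
      exact: measurable_indic (mlt _ otau).
    exact: measurable_discounted (measurable_optional_time otau).
  - by move=> n w _; rewrite lee_fin mulr_ge0// discounted_ge0.
  - by move=> w _; exact: ndg.
apply: eq_integral => w _; apply/esym/cvg_lim => //.
apply: cvg_near_cst; rewrite /g /discounted; have := tau0 w.
case E: (tau w) => [t| |]// t0; last by apply: nearW => n; rewrite mul0r.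
near=> n.
rewrite indicE mem_set ?mulr1//= E lte_fin.
rewrite (lt_le_trans (truncnS_gt t))// ler_nat ltnS.
by near: n; exact: nbhs_infty_ge.
Unshelve. all: by end_near. Qed.

Lemma discounted_before_le th p S tau : th < eta -> 1 < p -> p * th < eta -> 0 < S ->
  optional_time tau ->
  (\int[P]_w (discounted th (psi th) tau w * \1_[set w | (tau w < S%:E)%E] w)%:E <= 1)%E.
Proof.
move=> the p1 pthe S0 otau; have h := optional_stopping the p1 pthe S0 otau.
rewrite -(@lee_pmul2l _ (expR (psi th * S))%:E) ?lte_fin ?expR_gt0//.
rewrite -h mule1 -(expectation_expR the (ltW S0)); apply: ge0_le_integral => //.
- apply/measurable_EFinP; apply: measurable_funM; last exact: measurable_indic (mlt _ otau).
  by apply: measurableT_comp => //; exact: measurable_funM.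
- apply/measurable_EFinP; apply: measurableT_comp => //; exact: measurable_funM.
- by move=> w _; rewrite lee_fin ler_piMr ?expR_ge0// indicE; case: (_ \in _).
Qed.

Lemma discounted_le1 th p tau : th < eta -> 1 < p -> p * th < eta ->
  optional_time tau -> (\int[P]_w (discounted th (psi th) tau w)%:E <= 1)%E.
Proof.
move=> the p1 pthe otau; have h := @cvg_discounted_before th (psi th) tau otau.
rewrite -(cvg_lim _ h)//; apply: lime_le; first by apply/cvg_ex; eexists; exact: h.
by apply: nearW => n; exact: discounted_before_le the p1 pthe _ otau.
Qed.

Lemma discounted_eq1 th p C tau : th < eta -> 1 < p -> p * th < eta ->
  0 < psi th -> optional_time tau ->
  (forall S w, 0 < S -> (S%:E <= tau w)%E -> th * Y S w <= C) ->
  (\int[P]_w (discounted th (psi th) tau w)%:E = 1)%E.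
Proof.
move=> the p1 pthe psi0 otau bY; apply/eqP; rewrite eq_le (discounted_le1 the p1 pthe otau)/=.
have h := @cvg_discounted_before th (psi th) tau otau.
have c0 : ((\int[P]_w (discounted th (psi th) tau w * \1_[set w | (tau w < n.+1%:R%:E)%E] w)%:E
   + (expR (- (n.+1%:R * psi th)) * expR C)%:E)%E @[n --> \oo]) -->
   (\int[P]_w (discounted th (psi th) tau w)%:E + 0%:E)%E.
  apply: cvgeD => //; first exact: fin_num_adde_defl.
  apply: cvg_EFin_comp.
  by have := cvg_expRN_scale (expR C) psi0; rewrite -(cvg_shiftS _).
rewrite adde0 in c0.
rewrite -(cvg_lim _ c0)//; apply: lime_ge; first by apply/cvg_ex; eexists; exact: c0.
apply: nearW => n; set S : R := n.+1%:R.
have S0 : 0 < S by rewrite ltr0n.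
set B := [set w | (tau w < S%:E)%E]; have mB : measurable B by exact: mlt.
rewrite -(@lee_pmul2l _ (expR (psi th * S))%:E) ?lte_fin ?expR_gt0// mule1.
rewrite muleDr//; last exact: fin_num_adde_defl.
rewrite -(optional_stopping the p1 pthe S0 otau) -EFinM mulrA -expRD.
rewrite -[X in expR (_ - X)]mulrC subrr expR0 mul1r.
rewrite -(expectation_expR the (ltW S0)).
have mexp : measurable_fun setT (fun w => expR (th * Y S w)).
  by apply: measurableT_comp => //; exact: measurable_funM.
apply: (@le_trans _ _ (\int[P]_w ((expR (th * Y S w) * \1_B w)%:E + (expR C)%:E))%E).
  apply: ge0_le_integral => //.
  - exact/measurable_EFinP.
  - apply: emeasurable_funD => //; apply/measurable_EFinP; exact: measurable_funM.
  - move=> w _; rewrite -EFinD lee_fin indicE.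
    have [|/negP nB] := boolP (w \in B); first by rewrite mulr1 lerDl expR_ge0.
    rewrite mulr0 add0r ler_expR; apply: bY => //; rewrite leNgt; apply/negP => h'.
    by apply: nB; apply/mem_set.
rewrite ge0_integralD//.
- by rewrite integral_cst//= probability_setT mule1.
- by apply/measurable_EFinP; exact: measurable_funM.
Qed.

Let measurable_gt (t : R) : measurable [set s : measurableTypeR R | (t < s)%R].
Proof.
rewrite (_ : [set _ | _] = `]t, +oo[%classic); first exact: measurable_itv.
by apply/seteqP; split => s; rewrite /= in_itv/= andbT.
Qed.

Let measurable_expRN (q : R) :
  measurable_fun [set: measurableTypeR R] (fun s : R => (expR (- (q * s)))%:E).
Proof.
apply/measurable_EFinP; apply: measurableT_comp => //.
by apply: measurableT_comp => //; exact: measurable_funM.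
Qed.

Lemma exponential_head (q t : R) : 0 < q -> 0 <= t ->
  (\int[mu]_(s in [set s | (0 <= s)%R /\ (s <= t)%R]) (expR (- (q * s)))%:E =
   (q^-1 * (1 - expR (- (q * t))))%:E)%E.
Proof.
move=> q0; rewrite le_eqVlt => /orP[/eqP <-|t0].
  rewrite mulr0 oppr0 expR0 subrr mulr0 (_ : [set _ | _] = [set 0%R]).
    by rewrite integral_set1.
  apply/seteqP; split => s /=; first by move=> [h1 h2]; apply/eqP; rewrite eq_le h1 h2.
  by move=> ->.
have -> : [set s : R | (0 <= s)%R /\ (s <= t)%R] = `[0%R, t]%classic.
  by apply/seteqP; split => s; rewrite /= in_itv/= => /andP.
transitivity ((q^-1)%:E * exponential_prob q `[0%R, t]%classic)%E; last first.
  by rewrite exponential_prob_itv0c// mulNr -EFinB -EFinM.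
rewrite /exponential_prob -ge0_integralZl//.
- apply: eq_integral => s; rewrite inE/= in_itv/= => /andP[s0 _].
  by rewrite exponential_pdfE// -EFinM mulrA mulVf ?gt_eqF// mul1r mulNr.
- by apply/measurable_EFinP; apply: measurable_funTS; exact: measurable_exponential_pdf.
- by move=> s _; rewrite lee_fin exponential_pdf_ge0// ltW.
- by rewrite lee_fin invr_ge0 ltW.
Qed.

Lemma exponential_total (q : R) : 0 < q ->
  (\int[mu]_(s in [set s | (0 <= s)%R]) (expR (- (q * s)))%:E = (q^-1)%:E)%E.
Proof.
move=> q0.
rewrite -[in RHS](mulr1 q^-1) EFinM -(integral_exponential_pdf q0) -ge0_integralZl//.
- rewrite [LHS]integral_mkcond; apply: eq_integral => s _; rewrite patchE.
  case: ifPn; rewrite ?inE ?notin_setE /= => s0.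
    by rewrite exponential_pdfE// -EFinM mulrA mulVf ?gt_eqF// mul1r mulNr.
  by rewrite lt0_exponential_pdf ?mule0// ltNge; exact/negP.
- by apply/measurable_EFinP; exact: measurable_exponential_pdf.
- by move=> s _; rewrite lee_fin exponential_pdf_ge0// ltW.
- by rewrite lee_fin invr_ge0 ltW.
Qed.

Lemma exponential_tail (q t : R) : 0 < q -> 0 <= t ->
  (\int[mu]_(s in [set s | (t < s)%R]) (expR (- (q * s)))%:E =
   (q^-1 * expR (- (q * t)))%:E)%E.
Proof.
move=> q0 t0; have tot := exponential_total q0.
have D : [set s : R | (0 <= s)%R] = [set s | (0 <= s)%R /\ (s <= t)%R] `|` [set s | (t < s)%R].
  apply/seteqP; split => s /=; first by move=> s0; case: (leP s t) => h; [left|right].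
  by move=> [[]//|/ltW]; exact: le_trans.
move: tot; rewrite D ge0_integral_setU//.
- rewrite (exponential_head q0 t0); case: integral => [x| |]//=.
  by rewrite -EFinD => -[]; rewrite mulrBr mulr1 => h; congr EFin; lra.
- rewrite (_ : [set _ | _] = `[0%R, t]%classic); first exact: measurable_itv.
  by apply/seteqP; split => s; rewrite /= in_itv/= => /andP.
- by apply: measurable_funTS; exact: measurable_expRN.
- apply/disj_setPRL => s /= ts [_ st]; by move: ts; rewrite ltNge st.
Qed.

Let after tau (r : R) (z : R * T) : \bar R :=
  (if (tau z.2 < z.1%:E)%E then expR (Y (Num.max 0 z.1) z.2 - r * z.1) else 0)%:E.

Let after_ge0 tau r z : (0 <= after tau r z)%E.
Proof. by rewrite /after lee_fin; case: ifP => // _; exact: expR_ge0. Qed.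

Let measurable_after tau r : optional_time tau ->
  measurable_fun [set: (measurableTypeR R * T)%type] (after tau r).
Proof.
move=> otau.
suff : measurable_fun [set: (R * T)%type] (after tau r) by [].
apply/measurable_EFinP; apply: measurable_fun_ifT => //.
  apply: measurable_fun_lte; first exact: (measurableT_comp (measurable_optional_time otau)).
  by apply/measurable_EFinP.
apply: measurableT_comp => //; apply: measurable_funB; last exact: measurable_funM.
exact: measurable_right_continuous.
Qed.

Lemma expectation_after p r tau : 1 < eta -> 1 < p -> p < eta -> psi 1 < r ->
  optional_time tau ->
  (\int[P]_w \int[mu]_s (after tau r (s, w)) =
   ((r - psi 1)^-1)%:E * \int[P]_w (discounted 1 r tau w)%:E)%E.
Proof.
move=> eta1 p1 pe psir otau; have [tau0 _] := otau.
set q := r - psi 1; have q0 : 0 < q by rewrite subr_gt0.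
pose g (z : R * T) : \bar R := (if (tau z.2 < z.1%:E)%E then
  discounted 1 (psi 1) tau z.2 * expR (- (q * z.1)) else 0)%:E.
have mg : measurable_fun [set: (measurableTypeR R * T)%type] g.
  suff : measurable_fun [set: (R * T)%type] g by [].
  apply/measurable_EFinP; apply: measurable_fun_ifT => //.
    apply: measurable_fun_lte; first exact: (measurableT_comp (measurable_optional_time otau)).
    by apply/measurable_EFinP.
  apply: measurable_funM; first apply: measurableT_comp => //.
    exact: (@measurable_discounted _ _ _ tau0 (measurable_optional_time otau)).
  apply: measurableT_comp => //; apply: measurableT_comp => //; exact: measurable_funM.
have g0 z : (0 <= g z)%E.
  by rewrite /g lee_fin; case: ifP => // _; rewrite mulr_ge0 ?discounted_ge0 ?expR_ge0.
transitivity (\int[mu]_s \int[P]_w after tau r (s, w))%E.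
  by rewrite -(@fubini_tonelli _ _ _ _ _ mu P (after tau r)) //; exact: measurable_after.
transitivity (\int[mu]_s \int[P]_w g (s, w))%E.
  apply: eq_integral => s _; have [s0|s0] := ltP 0 s; last first.
    rewrite !integral0_eq// => w _; rewrite /g /after /= ltNge (le_trans _ (tau0 w)) ?lee_fin//.
  have -> : (\int[P]_w after tau r (s, w) = (expR (- (r * s)))%:E *
      \int[P]_w (expR (1 * Y s w) * \1_[set w | (tau w < s%:E)%E] w)%:E)%E.
    rewrite -ge0_integralZl//.
    - apply: eq_integral => w _; rewrite /after -EFinM indicE /=; congr EFin.
      rewrite (max_r (ltW s0)); case: ifPn => h.
        by rewrite mem_set// mulr1 mul1r -expRD addrC.
      by rewrite memNset ?mulr0//; exact/negP.
    - apply/measurable_EFinP; apply: measurable_funM; last exact: measurable_indic (mlt _ otau).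
      by apply: measurableT_comp => //; exact: measurable_funM.
  rewrite (optional_stopping (p := p))// ?mulr1// muleA -EFinM -expRD.
  rewrite -ge0_integralZl//.
  - apply: eq_integral => w _; rewrite /g -EFinM indicE /=; congr EFin.
    case: ifPn => h; last by rewrite memNset ?mulr0//; exact/negP.
    by rewrite mem_set// mulr1 mulrC; congr (_ * expR _); rewrite /q; ring.
  - apply/measurable_EFinP; apply: measurable_funM; last first.
      exact: measurable_indic (mlt _ otau).
    exact: measurable_discounted (measurable_optional_time otau).
  - by move=> w _; rewrite lee_fin mulr_ge0 ?discounted_ge0.
rewrite (@fubini_tonelli _ _ _ _ _ mu P g)//.
rewrite -ge0_integralZl//; first last.
- by rewrite lee_fin invr_ge0 ltW.
- by move=> w _; rewrite lee_fin discounted_ge0.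
- by apply/measurable_EFinP; exact: measurable_discounted (measurable_optional_time otau).
apply: eq_integral => w _; rewrite /g /discounted /=; have := tau0 w.
case: (tau w) => [t| |]//; last first.
  by move=> _; rewrite mule0 integral0_eq// => s _; rewrite mul0r; case: ifP.
rewrite lee_fin => t0.
transitivity ((expR (1 * Y t w - psi 1 * t))%:E *
   \int[mu]_(s in [set s | (t < s)%R]) (expR (- (q * s)))%:E)%E.
  rewrite -ge0_integralZl//.
  - rewrite [RHS]integral_mkcond; apply: eq_integral => s _.
    rewrite patchE lte_fin; case: ifPn => ts.
      by rewrite mem_set// EFinM.
    by rewrite memNset//; exact/negP.
  - by apply: measurable_funTS.
rewrite exponential_tail// -!EFinM mulrCA -expRD; congr (_ * expR _)%:E.
by rewrite /q; ring.
Qed.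

Lemma optional_time_cst0 : optional_time (cst 0%E).
Proof.
split => // t t0; rewrite (_ : [set _ | _] = setT).
  by rewrite -(setD0 setT); have [g0 + _] := sG t; apply.
by apply/seteqP; split => w //= _; rewrite lte_fin.
Qed.

Let gain_on_path (r al c v : R) tau w : 0 < r -> (0 <= tau w)%E ->
  (\int[mu]_s after (cst 0%E) r (s, w) < +oo)%E ->
  (\int[mu]_(s in [set s | (0 <= s)%R /\ (s%:E <= tau w)%E])
     (expR (- (r * s)) * (al * (v * expR (Y s w)) - c))%:E =
   (al * v)%:E * (\int[mu]_s after (cst 0%E) r (s, w) - \int[mu]_s after tau r (s, w)) -
   (c / r * (1 - discounted 0 r tau w))%:E)%E.
Proof.
move=> r0 tau0 Afin.
set S := [set s | (0 <= s)%R /\ (s%:E <= tau w)%E].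
pose S' := [set s | (0 < s)%R /\ (s%:E <= tau w)%E].
pose E s := (expR (Y (Num.max 0 s) w - r * s)).
have mE : measurable_fun [set: measurableTypeR R] (fun s => (E s)%:E).
  apply/measurable_EFinP; apply: measurableT_comp => //.
  apply: measurable_funB; last exact: measurable_funM.
  apply: (measurableT_comp (measurable_right_continuous mY rcY) (g := fun s => (s, w))).
  exact: measurable_fun_pair.
have mS : measurable (S : set (measurableTypeR R)).
  rewrite /S; case: (tau w) tau0 => [t| |]// t0.
    rewrite (_ : [set _ | _] = `[0%R, t]%classic); first exact: measurable_itv.
    by apply/seteqP; split => s; rewrite /= in_itv/= lee_fin => /andP.
  rewrite (_ : [set _ | _] = `[0%R, +oo[%classic); first exact: measurable_itv.
  by apply/seteqP; split => s; rewrite /= in_itv/= andbT ?leey => // -[].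
have S'E : S' = S `\ 0.
  apply/seteqP; split => s; rewrite /S /S' /=; first by rewrite lt_def => -[/andP[/eqP ? ?] ?].
  by move=> [[s0 st] /eqP sn]; rewrite lt_def sn s0.
have mS' : measurable (S' : set (measurableTypeR R)).
  by rewrite S'E; exact: measurableD.
have SS' (f : R -> \bar R) : measurable_fun [set: measurableTypeR R] f ->
    (\int[mu]_(s in S) f s = \int[mu]_(s in S') f s)%E.
  move=> mf; rewrite S'E; apply/esym/integral_setD1; first by rewrite -S'E.
  exact: measurable_funTS.
have afterE ta : (forall s, (ta w < s%:E)%E -> (0 < s)%R) ->
    (\int[mu]_s after ta r (s, w) = \int[mu]_(s in [set s | (ta w < s%:E)%E]) (E s)%:E)%E.
  move=> ta0; rewrite [RHS]integral_mkcond; apply: eq_integral => s _.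
  rewrite /after patchE /=; case: ifPn => h; first by rewrite mem_set.
  by rewrite memNset//; exact/negP.
have tauS s : (tau w < s%:E)%E -> (0 < s)%R.
  by move=> h; have := le_lt_trans tau0 h; rewrite lte_fin.
have A_split : (\int[mu]_s after (cst 0%E) r (s, w) =
    \int[mu]_(s in S') (E s)%:E + \int[mu]_s after tau r (s, w))%E.
  rewrite (afterE tau)// (afterE (cst 0%E)) => [|s]; last by rewrite lte_fin.
  rewrite -ge0_integral_setU//.
  - congr (integral _ _ _); apply/seteqP; split => s /=; rewrite /S' /= ?lte_fin.
      by move=> s0; case: (leP s%:E (tau w)) => h; [left|right].
    by move=> [[]//|/tauS].
  - have := emeasurable_fun_o_infty (f := EFin) measurableT (@EFin_measurable R setT) (tau w).
    by rewrite setTI.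
  - exact: measurable_funTS.
  - by move=> s _; rewrite lee_fin expR_ge0.
  - by apply/disj_setPRL => s /= ts [_]; rewrite leNgt ts.
have IE : (0 <= \int[mu]_(s in S') (E s)%:E)%E.
  by apply: integral_ge0 => s _; rewrite lee_fin expR_ge0.
have II : (0 <= \int[mu]_s after tau r (s, w))%E by exact: integral_ge0.
have fin1 : (\int[mu]_(s in S') (E s)%:E \is a fin_num)%E.
  rewrite ge0_fin_numE//; apply: le_lt_trans Afin.
  by rewrite A_split leeDl.
have fin2 : (\int[mu]_s after tau r (s, w) \is a fin_num)%E.
  rewrite ge0_fin_numE//; apply: le_lt_trans Afin.
  by rewrite A_split leeDr.
rewrite A_split addeK//.
have expE : (\int[mu]_(s in S') (expR (- (r * s)))%:E =
    (r^-1 * (1 - discounted 0 r tau w))%:E)%E.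
  rewrite -SS'//; rewrite /S /discounted; case: (tau w) tau0 => [t| |]// t0.
    under eq_set do rewrite lee_fin; rewrite exponential_head//.
    by rewrite mul0r add0r.
  rewrite subr0 mulr1 -(exponential_total r0); congr (integral _ _ _).
  by apply/seteqP; split => s /=; [case|rewrite leey].
transitivity (\int[mu]_(s in S) ((al * v * E s)%:E - (c * expR (- (r * s)))%:E))%E.
  apply: eq_integral => s /set_mem [s0 _]; rewrite -EFinB; congr EFin.
  by rewrite /E max_r// expRD expRN; ring.
rewrite SS'; last first.
  apply: emeasurable_funB; first by under eq_fun do rewrite EFinM; exact: measurable_funeM.
  under eq_fun do rewrite EFinM; apply: measurable_funeM.
  exact: measurable_expRN.
have integ (f : R -> R) : measurable_fun [set: measurableTypeR R] (fun s => (f s)%:E) ->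
    (forall s, 0 <= f s) -> (\int[mu]_(s in S') (f s)%:E \is a fin_num)%E ->
    mu.-integrable S' (fun s => (f s)%:E).
  move=> mf f0 ffin; apply/integrableP; split; first exact: measurable_funTS.
  under eq_integral do rewrite gee0_abs ?lee_fin//.
  by rewrite -ge0_fin_numE// integral_ge0// => s _; rewrite lee_fin.
have i1 : mu.-integrable S' (fun s => (E s)%:E) by apply: integ => // s; exact: expR_ge0.
have i2 : mu.-integrable S' (fun s => (expR (- (r * s)))%:E).
  apply: (integ _ (measurable_expRN r) (fun s => expR_ge0 _)).
  by rewrite expE.
rewrite integralB//; first last.
- under eq_fun do rewrite EFinM; exact: integrableZl.
- under eq_fun do rewrite EFinM; exact: integrableZl.
congr (_ - _)%E.
  by under eq_integral do rewrite EFinM; rewrite integralZl.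
under eq_integral do rewrite EFinM.
by rewrite integralZl// expE -EFinM mulrA.
Qed.

Lemma expected_gainE p (r al c v D0 D1 : R) (V : R -> T -> R) tau :
  measure_is_complete P -> {ae P, forall w t, V t w = v * expR (Y t w)} ->
  0 < r -> 1 < eta -> 1 < p -> p < eta -> psi 1 < r -> optional_time tau ->
  (\int[P]_w (discounted 0 r tau w)%:E = D0%:E)%E ->
  (\int[P]_w (discounted 1 r tau w)%:E = D1%:E)%E ->
  expected_gain P r al c V tau =
    (al * v * ((1 - D1) / (r - psi 1)) - c / r * (1 - D0))%:E.
Proof.
move=> cP VE r0 eta1 p1 pe psir otau D0E D1E; have [tau0 _] := otau.
set q := r - psi 1; have q0 : 0 < q by rewrite subr_gt0.
pose A w : \bar R := (\int[mu]_s after (cst 0%E) r (s, w))%E.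
pose I w : \bar R := (\int[mu]_s after tau r (s, w))%E.
have mAI ta : optional_time ta ->
    measurable_fun setT (fun w => \int[mu]_s after ta r (s, w))%E.
  move=> ota; exact: (measurable_fun_fubini_tonelli_G (m1 := mu) (after ta r)
    (measurable_after r ota)).
have A0 w : (0 <= A w)%E by exact: integral_ge0.
have I0 w : (0 <= I w)%E by exact: integral_ge0.
have EA : (\int[P]_w A w = (q^-1)%:E)%E.
  rewrite (expectation_after eta1 p1 pe psir optional_time_cst0).
  rewrite (eq_integral (fun=> 1%E)) => [|w _]; last first.
    by rewrite /discounted/= Y0 !mulr0 subrr expR0.
  by rewrite integral_cst//= mul1e probability_setT mule1.
have EI : (\int[P]_w I w = (q^-1 * D1)%:E)%E.
  by rewrite (expectation_after eta1 p1 pe psir otau) D1E.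
have iA : P.-integrable setT A.
  apply/integrableP; split; first exact: (mAI _ optional_time_cst0).
  by under eq_integral do rewrite gee0_abs//; rewrite EA ltry.
have iI : P.-integrable setT I.
  apply/integrableP; split; first exact: mAI.
  by under eq_integral do rewrite gee0_abs//; rewrite EI ltry.
have iD : P.-integrable setT (fun w => (discounted 0 r tau w)%:E).
  apply/integrableP; split.
    by apply/measurable_EFinP; exact: measurable_discounted (measurable_optional_time otau).
  under eq_integral do rewrite gee0_abs ?lee_fin ?discounted_ge0//.
  by rewrite D0E ltry.
have i1 : P.-integrable setT (fun=> 1%E : \bar R) by exact: finite_measure_integrable_cst.
pose h w : \bar R := ((al * v)%:E * (A w - I w) - (c / r)%:E * (1 - (discounted 0 r tau w)%:E))%E.
have iAI : P.-integrable setT (fun w => (al * v)%:E * (A w - I w))%E.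
  by apply: integrableZl => //; exact: integrableB.
have i1D : P.-integrable setT (fun w => (c / r)%:E * (1 - (discounted 0 r tau w)%:E))%E.
  by apply: integrableZl => //; exact: integrableB.
have gh : ae_eq P setT h (fun w => \int[mu]_(s in [set s | (0 <= s)%R /\ (s%:E <= tau w)%E])
     (expR (- (r * s)) * (al * V s w - c))%:E)%E.
  have Aae := integrable_ae measurableT iA.
  apply: filterS2 VE Aae => w VE Afin _.
  have {}Afin : (A w < +oo)%E by rewrite -ge0_fin_numE//; exact: Afin.
  rewrite /h -EFinB -EFinM -gain_on_path//.
  by apply: eq_integral => s _; rewrite VE.
have ih : P.-integrable setT h.
  rewrite /h; apply: (integrableB measurableT iAI i1D).
have mh := measurable_int P ih.
transitivity (\int[P]_w h w)%E.
  have mg := ae_measurable_fun cP gh mh.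
  exact/esym/(ae_eq_integral _ _ measurableT mh mg gh).
rewrite integralB// !integralZl//; last 2 first.
- exact: integrableB.
- exact: integrableB.
rewrite [X in ((al * v)%:E * X)%E](integralB measurableT iA iI).
rewrite [X in ((c / r)%:E * X)%E](integralB measurableT i1 iD).
rewrite EA EI D0E integral_cst//= probability_setT mule1.
transitivity (al * v * (q^-1 - q^-1 * D1) - c / r * (1 - D0))%:E; first by [].
by congr EFin; ring.
Qed.

End optional_stopping.

(** * Path regularity *)

(* The last clause excludes negative jumps without mentioning left limits. *)
Definition upward_jumping {R : realType} (x : R -> R) :=
  [/\ x 0 = 0, forall t, 0 <= t -> x u @[u --> t^'+] --> x t &
      forall S b, 0 < S -> (forall u, 0 <= u < S -> b <= x u) -> b <= x S].

Section paths.
Context {d : measure_display} {T : measurableType d} {R : realType}.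
Variable P : probability T R.
Variables (W : R -> {RV P >-> R}) (N : R -> {RV P >-> nat}) (U : nat -> {RV P >-> R}).
Variables (m sigma a eta : R).
Hypotheses (a_gt0 : 0 < a) (eta_gt0 : 0 < eta).
Hypothesis P_complete : measure_is_complete P.
Hypothesis W_brownian : brownian_motion W.
Hypothesis N_poisson : poisson_process a N.
Hypothesis U_exponential : iid_exponential eta U.
Hypothesis WNU_independent : independent_WNU W N U.

Notation X := (jump_diffusion m sigma W N U).

Let ae_U_ge0 : {ae P, forall w i, 0 <= U i w}.
Proof.
apply/ae_foralln => i; have [_ Uexp] := U_exponential.
exists (U i @^-1` `]-oo, 0[%classic); split.
- by rewrite -[X in measurable X]setTI; apply: measurable_funPT.
- by apply: etrans (Uexp i _ _) _ => //; exact: exponential_prob_neg.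
- by move=> w /= /negP; rewrite -ltNge in_itv.
Qed.

Lemma jump_diffusion_paths : {ae P, forall w, upward_jumping (X ^~ w)}.
Proof.
have nat_eq (k l : nat) : `|k%:R - l%:R : R| < 1 -> l = k.
  rewrite ltr_norml => /andP[h1 h2].
  by case: (ltngtP l k) => // h; exfalso; move: h; rewrite -(ler_nat R) -natr1; lra.
have [aeW0 aeWc _ _] := W_brownian; have [aeN0 aeN _ _] := N_poisson.
near=> w; have W0 : W 0 w = 0 by near: w.
have Wc : {within `[0, +oo[, continuous (fun t => W t w)} by near: w.
have N0 : N 0 w = 0%N by near: w.
have U0 : forall i, 0 <= U i w by near: w; exact: ae_U_ge0.
have [Nle Nr] : (forall s t, 0 <= s -> s <= t -> (N s w <= N t w)%N) /\
    (forall t, 0 <= t -> (N u w)%:R @[u --> t^'+] --> ((N t w)%:R : R)) by near: w.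
have J_le s t : 0 <= s -> s <= t -> \sum_(i < N s w) U i w <= \sum_(i < N t w) U i w.
  move=> s0 st; rewrite -(subnKC (Nle _ _ s0 st)) big_split_ord/= lerDl.
  exact: sumr_ge0.
have [Wc0 Wr0] := (continuous_within_itvcyP _ _).1 Wc.
have Wr t : 0 <= t -> W u w @[u --> t^'+] --> W t w.
  rewrite le_eqVlt => /orP[/eqP <-//|t0].
  by apply: cvg_at_right_filter; apply: Wc0; rewrite in_itv/= andbT.
split.
- by rewrite /jump_diffusion W0 N0 big_ord0 !mulr0 !addr0.
- move=> t t0; apply: cvgD.
    apply: cvgD; first by apply: cvgM; [exact: cvg_cst|exact: cvg_at_right_filter].
    by apply: cvgM; [exact: cvg_cst|exact: Wr].
  apply: cvg_near_cst.
  have /cvgrPdist_lt/(_ 1 ltr01) := Nr _ t0; apply: filterS => u Ntu.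
  by rewrite (nat_eq _ _ Ntu).
move=> S b S0 bX.
pose g u := b + m * (S - u) + sigma * (W S w - W u w).
have gb : g u @[u --> S^'-] --> b.
  rewrite -[X in _ --> X](_ : b + m * (S - S) + sigma * (W S w - W S w) = b); last by ring.
  apply: cvgD.
    apply: cvgD; first exact: cvg_cst.
    apply: cvgM; first exact: cvg_cst.
    by apply: cvgB; [exact: cvg_cst|exact: cvg_at_left_filter].
  apply: cvgM; first exact: cvg_cst.
  apply: cvgB; first exact: cvg_cst.
  by apply: cvg_at_left_filter; apply: Wc0; rewrite in_itv/= andbT.
apply: (cvgr_to_le gb); near=> u.
have u0 : 0 <= u by near: u; exact: nbhs_left_ge.
have uS : u < S by near: u; exact: nbhs_left_lt.
have := bX u; rewrite u0 uS => /(_ isT).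
have := J_le u S u0 (ltW uS); rewrite /g /jump_diffusion; lra.
Unshelve. all: by end_near. Qed.

Let good := [set w | upward_jumping (X ^~ w)].

Let mgood : measurable good.
Proof.
rewrite -(setCK good); apply: measurableC; apply: P_complete.
exact: jump_diffusion_paths.
Qed.

(* Zeroing the null set of irregular paths makes every path regular, hence hitting times
   can be analysed pathwise; completeness of [P] makes this set measurable. *)
Definition path_version (t : R) (w : T) : R := X t w * \1_good w.
Notation Y := path_version.

Lemma path_version_ae : {ae P, forall w t, Y t w = X t w}.
Proof.
apply: filterS jump_diffusion_paths => w gw t.
by rewrite /Y indicE mem_set// mulr1.
Qed.

Lemma measurable_path_version t : measurable_fun setT (Y t).
Proof.
apply: measurable_funM; last exact: measurable_indic.
exact: (measurable_jump_diffusion (P := P)).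
Qed.

Lemma upward_jumping_path_version w : upward_jumping (Y ^~ w).
Proof.
have [gw|gw] := pselect (good w).
  by rewrite (_ : Y ^~ w = X ^~ w)//; apply/funext => t; rewrite /Y indicE mem_set// mulr1.
rewrite (_ : Y ^~ w = cst 0); last first.
  by apply/funext => t; rewrite /Y indicE memNset// mulr0.
split => //; first by move=> t _; exact: cvg_cst.
by move=> S b S0 /(_ 0); rewrite lexx S0; apply.
Qed.

Definition augmented_filtration v t : set_system T :=
  <<s sigma_process `[0, t] (exp_process X v) `|` P.-negligible >>.
Notation G := augmented_filtration.

Lemma augmented_filtration_sigma_algebra v t : sigma_algebra setT (G v t).
Proof. exact: smallest_sigma_algebra. Qed.

Lemma augmented_filtration_le v s t : s <= t -> G v s `<=` G v t.
Proof.
move=> st; apply: sub_sigma_algebra2; apply: setSU; apply: sub_sigma_algebra2.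
apply: bigcup_subset => u/=; rewrite !in_itv/= => /andP[-> us].
exact: le_trans st.
Qed.

Lemma measurable_augmented_filtration v t : G v t `<=` measurable.
Proof.
move=> A /(observable_filtration P_complete N_poisson).
by case.
Qed.

Lemma augmented_filtration_negligible v t A : P.-negligible A -> G v t A.
Proof. by move=> nA; apply: sub_sigma_algebra; right. Qed.

Lemma augmented_filtration_eq v t A B : {ae P, forall w, A w <-> B w} ->
  G v t A -> G v t B.
Proof.
move=> AB GA.
have GU C D : G v t C -> G v t D -> G v t (C `|` D).
  move=> GC GD; rewrite -bigcup2E.
  have [_ _ + ] := augmented_filtration_sigma_algebra v t; apply.
  move=> [//|[//|i]]/=; have [+ _ _] := augmented_filtration_sigma_algebra v t; exact.
have GC C : G v t C -> G v t (~` C).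
  have [_ + _] := augmented_filtration_sigma_algebra v t.
  by move=> h /h; rewrite setTD.
have n1 : P.-negligible (A `\` B) by apply: negligibleS AB => w /= [Aw nB] [/(_ Aw)].
have n2 : P.-negligible (B `\` A) by apply: negligibleS AB => w /= [Bw nA] [_ /(_ Bw)].
rewrite (_ : B = ~` (~` A `|` (A `\` B)) `|` (B `\` A)).
  apply: (GU); last exact: augmented_filtration_negligible.
  apply: (GC); apply: (GU); first exact: GC.
  exact: augmented_filtration_negligible.
apply/seteqP; split => w /=.
  move=> Bw; have [Aw|nA] := pselect (A w); last by right.
  by left; case => // -[].
move=> [|[]//] h; apply: contrapT => nB; apply: h.
by have [Aw|nA] := pselect (A w); [right|left].
Qed.

Lemma augmented_filtration_path v l q t : 0 < v -> 0 <= q -> q <= t ->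
  G v t [set w | Y q w < l].
Proof.
move=> v0 q0 qt.
apply: (@augmented_filtration_eq _ _ [set w | exp_process X v q w < v * expR l]).
  apply: filterS path_version_ae => w /(_ q) Yq /=.
  by rewrite Yq /exp_process ltr_pM2l// ltr_expR.
apply: sub_sigma_algebra; left; apply: sub_sigma_algebra.
exists q; first by rewrite /= in_itv/= q0.
exists `]-oo, v * expR l[%classic => //.
by rewrite setTI; apply/seteqP; split => w; rewrite /= in_itv.
Qed.

Lemma path_version_martingale v th s t A : th < eta -> 0 <= s -> s <= t -> G v s A ->
  (\int[P]_w (expR (th * Y t w) * \1_A w)%:E =
   (expR (laplace_exponent m sigma a eta th * (t - s)))%:E *
     \int[P]_w (expR (th * Y s w) * \1_A w)%:E)%E.
Proof.
move=> the s0 st GA.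
have mA := measurable_augmented_filtration GA.
have YX u : (\int[P]_w (expR (th * Y u w) * \1_A w)%:E =
             \int[P]_w (expR (th * X u w) * \1_A w)%:E)%E.
  have mf (Z : T -> R) : measurable_fun setT Z ->
      measurable_fun setT (fun w => (expR (th * Z w) * \1_A w)%:E).
    move=> mZ; apply/measurable_EFinP; apply: measurable_funM; last exact: measurable_indic.
    by apply: measurableT_comp => //; exact: measurable_funM.
  apply: ae_eq_integral => //.
  - by apply: mf; exact: measurable_path_version.
  - by apply: mf; exact: (measurable_jump_diffusion (P := P)).
  - by apply: filterS path_version_ae => w /(_ u) ->.
rewrite (YX t) (YX s); apply: (exponential_martingale m sigma a_gt0 eta_gt0 W_brownian
  N_poisson U_exponential WNU_independent the s0 st).
exact: (observable_filtration P_complete N_poisson GA).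
Qed.

Lemma optional_stopping_time v tau :
  stopping_time (usual_filtration P (exp_process X v)) tau ->
  optional_time (G v) tau.
Proof.
move=> [tau0 Ft]; split => // t t0.
rewrite (_ : [set w | _] = \bigcup_n [set w | (tau w <= (t * n%:R / n.+1%:R)%:E)%E]).
  have [_ _ + ] := augmented_filtration_sigma_algebra v t; apply => n.
  have : 0 <= t * n%:R / n.+1%:R by rewrite divr_ge0// mulr_ge0// ltW.
  move=> /Ft; apply => /=.
  by rewrite ltr_pdivrMr// ltr_pM2l// ltr_nat.
apply/seteqP; split => w /=; last first.
  move=> [n _ /= h]; apply: le_lt_trans h _.
  by rewrite lte_fin ltr_pdivrMr// ltr_pM2l// ltr_nat.
move: (tau0 w); case E: (tau w) => [x| |]// _.
rewrite lte_fin => xt; pose n := Num.truncn (t / (t - x)); exists n => //=.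
rewrite E lee_fin ler_pdivlMr//.
have : t / (t - x) < n.+1%:R by exact: truncnS_gt.
rewrite ltr_pdivrMr ?subr_gt0//.
have -> : n.+1%:R = n%:R + 1 :> R by rewrite -natr1.
by move=> h; nra.
Qed.

Lemma stopping_time_optional v tau : optional_time (G v) tau ->
  stopping_time (usual_filtration P (exp_process X v)) tau.
Proof.
move=> [tau0 otau]; split => // t t0 u /= tu.
have [_ GC GU] := augmented_filtration_sigma_algebra v u.
pose e n : R := t + (u - t) / n.+1%:R.
have e_le n : t < e n <= u.
  rewrite ltrDl divr_gt0 ?subr_gt0//= -lerBrDl ler_piMr ?subr_ge0 ?(ltW tu)//.
  by rewrite invf_le1 ?ltr0n// ler1n.
rewrite (_ : [set w | _] = setT `\` \bigcup_n (setT `\` [set w | (tau w < (e n)%:E)%E])).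
  apply: (GC); apply: GU => n; apply: (GC); have /andP[te eu] := e_le n.
  by apply: augmented_filtration_le eu _ _; apply: otau; exact: le_lt_trans te.
apply/seteqP; split => w /=.
  move=> tw; split => // -[n _ [_]]; apply; apply: le_lt_trans tw _.
  by rewrite lte_fin; have /andP[] := e_le n.
move=> [_ h]; rewrite leNgt; apply/negP => tw; apply: h.
have [x tx xw] : exists2 x : R, t < x & (x%:E <= tau w)%E.
  move: tw; case: (tau w) => [x| |]//; first by rewrite lte_fin => tx; exists x.
  by move=> _; exists (t + 1); rewrite ?ltrDl// leey.
pose n := Num.truncn ((u - t) / (x - t)); exists n => //; split => //=.
apply/negP; rewrite -leNgt; apply: le_trans xw; rewrite lee_fin /e -lerBrDl.
rewrite ler_pdivrMr ?ltr0n// mulrC -ler_pdivrMr ?subr_gt0//.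
by apply: ltW; exact: truncnS_gt.
Qed.

End paths.

(** * Passage times *)

Section null_functions.
Context {d : measure_display} {T : measurableType d} {R : realType}.
Variable P : probability T R.

Lemma ae0_dominated (f : T -> R) (g : nat -> T -> R) (e : nat -> R) :
  (forall n w, 0 <= f w <= g n w) -> (forall n, measurable_fun setT (g n)) ->
  (forall n, (\int[P]_w (g n w)%:E <= (e n)%:E)%E) -> e n @[n --> \oo] --> (0 : R) ->
  {ae P, forall w, f w = 0}.
Proof.
move=> fg mg ge e0.
pose h w := einfs (fun n => (g n w)%:E) 0%N.
have mh : measurable_fun setT h.
  by apply: (measurable_fun_einfs (f := fun n w => (g n w)%:E)) => n; exact/measurable_EFinP.
have fh w : ((f w)%:E <= h w)%E.
  by apply: le_ereal_inf_tmp => _ [n _ <-]; rewrite lee_fin; have /andP[] := fg n w.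
have hg n w : (h w <= (g n w)%:E)%E by apply: ereal_inf_lbound; exists n.
have h0 w : (0 <= h w)%E.
  by apply: le_trans (fh w); rewrite lee_fin; have /andP[] := fg 0%N w.
have ih : (\int[P]_w h w = 0)%E.
  apply/eqP; rewrite eq_le integral_ge0// andbT.
  apply: (cvge_ge _ (cvg_EFin_comp _ e0)); apply: nearW => n.
  apply: le_trans (ge n); apply: ge0_le_integral => //.
  - exact/measurable_EFinP.
have /(ae_eq_integral_abs _ measurableT mh) : (\int[P]_w `|h w| = 0)%E.
  by under eq_integral do rewrite gee0_abs//.
apply: filterS => w /(_ I) /= hw.
apply/eqP; rewrite eq_le; have /andP[-> _] := fg 0%N w; rewrite andbT.
by have := fh w; rewrite hw lee_fin.
Qed.

Lemma ae0_integral_le0 (f : T -> R) : (forall w, 0 <= f w) -> measurable_fun setT f ->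
  (\int[P]_w (f w)%:E <= 0)%E -> {ae P, forall w, f w = 0}.
Proof.
move=> f0 mf f1; apply: (@ae0_dominated f (fun=> f) (fun=> 0)) => //.
- by move=> _ w; rewrite f0 lexx.
- exact: cvg_cst.
Qed.

End null_functions.

Section passage_times.
Context {d : measure_display} {T : measurableType d} {R : realType}.
Variable P : probability T R.
Variables (Y : R -> T -> R) (psi : R -> R) (eta : R) (G : R -> set_system T).
Hypothesis mY : forall t, measurable_fun setT (Y t).
Hypothesis upY : forall w, upward_jumping (Y ^~ w).
Hypothesis sG : forall t, sigma_algebra setT (G t).
Hypothesis ndG : forall s t, s <= t -> G s `<=` G t.
Hypothesis mG : forall t, G t `<=` measurable.
Hypothesis eqG : forall t A B, {ae P, forall w, A w <-> B w} -> G t A -> G t B.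
Hypothesis YG : forall l q t, 0 <= q -> q <= t -> G t [set w | Y q w < l].
Hypothesis martY : forall th s t A, th < eta -> 0 <= s -> s <= t -> G s A ->
  (\int[P]_w (expR (th * Y t w) * \1_A w)%:E =
   (expR (psi th * (t - s)))%:E * \int[P]_w (expR (th * Y s w) * \1_A w)%:E)%E.
Variables (lambda r : R).
Hypotheses (eta_gt1 : 1 < eta) (lambda_gt0 : 0 < lambda) (r_gt0 : 0 < r).
Hypotheses (psi_lambda : psi (- lambda) = r) (psi_lt : psi 1 < r).

Notation optional_time := (optional_time G).
Notation discounted := (discounted Y).

Let Nlambda_lt : - lambda < eta.
Proof. by move: eta_gt1 lambda_gt0; lra. Qed.

Let Nlambda2_lt : 2 * - lambda < eta.
Proof. by move: eta_gt1 lambda_gt0; lra. Qed.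

Let Y0 w : Y 0 w = 0. Proof. by case: (upY w). Qed.
Let rcY t w : 0 <= t -> Y u w @[u --> t^'+] --> Y t w.
Proof. by case: (upY w) => _ + _; exact. Qed.
Let njY S b w : 0 < S -> (forall u, 0 <= u < S -> b <= Y u w) -> b <= Y S w.
Proof. by case: (upY w) => _ _; exact. Qed.

Let mdisc th q tau : optional_time tau -> measurable_fun setT (discounted th q tau).
Proof.
move=> otau; apply: (measurable_discounted mY rcY); first by case: otau.
exact: (@measurable_optional_time _ T R G mG tau otau).
Qed.

Lemma optional_time_ae tau tau' : (forall w, (0 <= tau' w)%E) ->
  {ae P, forall w, tau w = tau' w} -> optional_time tau -> optional_time tau'.
Proof.
move=> tau0 tt [_ otau]; split => // t t0; apply: eqG (otau _ t0).
by apply: filterS tt => w /= ->.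
Qed.

Lemma discounted_ae th q tau tau' : {ae P, forall w, tau w = tau' w} ->
  optional_time tau -> optional_time tau' ->
  (\int[P]_w (discounted th q tau w)%:E = \int[P]_w (discounted th q tau' w)%:E)%E.
Proof.
move=> tt otau otau'; apply: ae_eq_integral => //.
- by apply/measurable_EFinP; exact: mdisc.
- by apply/measurable_EFinP; exact: mdisc.
- by apply: filterS tt => w; rewrite /discounted /= => ->.
Qed.

Definition passage (l : R) (w : T) : \bar R :=
  ereal_inf (EFin @` [set t | 0 <= t /\ Y t w < l]).

Lemma passage_ge0 l w : (0 <= passage l w)%E.
Proof. by apply: le_ereal_inf_tmp => _ [t [t0 _] <-]; rewrite lee_fin. Qed.

Lemma passage_ltP l w t :
  (passage l w < t%:E)%E <-> exists s, [/\ 0 <= s, s < t & Y s w < l].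
Proof.
split=> [/ereal_inf_lt[_ [s [s0 Ys] <-]]|[s [s0 st Ys]]].
  by rewrite lte_fin => st; exists s.
by apply: (@le_lt_trans _ _ s%:E); [apply: ereal_inf_lbound; exists s|rewrite lte_fin].
Qed.

Lemma le_passage l w t : 0 <= t -> (t%:E <= passage l w)%E -> l <= 0 -> l <= Y t w.
Proof.
rewrite le_eqVlt => /orP[/eqP <- _|t0 tl _]; first by rewrite Y0.
apply: njY => // u /andP[u0 ut]; rewrite leNgt; apply/negP => Yu.
have : (passage l w < t%:E)%E by apply/passage_ltP; exists u.
by rewrite ltNge tl.
Qed.

Lemma passage_level l w t : l <= 0 -> passage l w = t%:E -> Y t w = l.
Proof.
move=> l0 tl; have t0 : 0 <= t by rewrite -lee_fin -tl passage_ge0.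
apply/eqP; rewrite eq_le le_passage ?tl// andbT leNgt; apply/negP => lY.
have [e /= e0 he] : \forall u \near t^'+, l < Y u w.
  by apply: cvgr_gt lY; exact: rcY.
have /passage_ltP[s [s0 se Ys]] : (passage l w < (t + e)%:E)%E by rewrite tl lte_fin ltrDl.
have : (t%:E <= s%:E)%E by rewrite -tl; apply: ereal_inf_lbound; exists s.
rewrite lee_fin le_eqVlt => /orP[/eqP ts|ts]; first by move: lY; rewrite ts ltNge (ltW Ys).
have := he s; rewrite /= ltr0_norm ?subr_lt0// opprB ltrBlDl => /(_ se ts).
by rewrite ltNge (ltW Ys).
Qed.

Lemma optional_passage l : optional_time (passage l).
Proof.
split=> [w|t t0]; first exact: passage_ge0.
have [Gset0 GC GU] := sG t.
rewrite (_ : [set _ | _] = \bigcup_n \bigcup_k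
    (if k%:R / n.+1%:R < t then [set w | Y (k%:R / n.+1%:R) w < l] else set0)).
  apply: (GU) => n; apply: (GU) => k; case: ifPn => // /ltW h.
  by apply: YG => //; rewrite divr_ge0.
apply/seteqP; split => w /=; last first.
  move=> [n _ [k _]]; case: ifPn => //= h Yl; apply/passage_ltP.
  by exists (k%:R / n.+1%:R); rewrite divr_ge0.
move=> /passage_ltP[s [s0 st Ys]].
have [e /= e0 he] : \forall u \near s^'+, u < t /\ Y u w < l.
  near=> u; split; first by near: u; exact: nbhs_right_lt.
  by near: u; apply: cvgr_lt Ys; exact: rcY.
pose n := Num.truncn e^-1.
have n0 : 0 < n.+1%:R^-1 :> R by rewrite invr_gt0 ltr0n.
have ne : n.+1%:R^-1 < e by rewrite invf_plt ?posrE// truncnS_gt.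
have gE : grid n.+1%:R^-1 s = (Num.truncn (s / n.+1%:R^-1)).+1%:R / n.+1%:R.
  by rewrite /grid mulrC.
have sg := grid_gt s n0; have gs := grid_le n0 s0.
have [|gt Yg] := he _ _ sg.
  by rewrite /= ltr0_norm ?subr_lt0// opprB ltrBlDl (le_lt_trans gs)// ltrD2l.
exists n => //; exists (Num.truncn (s / n.+1%:R^-1)).+1 => //.
by rewrite -gE gt.
Unshelve. all: by end_near. Qed.

Lemma discounted0_passage l : l < 0 ->
  (\int[P]_w (discounted 0 r (passage l) w)%:E = (expR (lambda * l))%:E)%E.
Proof.
move=> l0; have op := optional_passage l.
have h : (\int[P]_w (discounted (- lambda) r (passage l) w)%:E = 1)%E.
  rewrite -psi_lambda.
  apply: (@discounted_eq1 _ _ _ P Y psi eta G mY rcY Y0 sG ndG mG martY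
      (- lambda) 2 (- lambda * l));
    rewrite ?psi_lambda ?ltr1n//.
  by move=> S w S0 /(le_passage (ltW S0))/(_ (ltW l0)); rewrite ler_nM2l ?oppr_lt0.
have E w : (discounted (- lambda) r (passage l) w)%:E =
    ((expR (- (lambda * l)))%:E * (discounted 0 r (passage l) w)%:E)%E.
  rewrite -EFinM /discounted.
  case tE: (passage l w) => [t| |]; rewrite ?mulr0//.
  by rewrite (passage_level (ltW l0) tE) mul0r sub0r -expRD mulNr.
rewrite (eq_integral _ _ (fun w _ => E w)) in h.
have D0 w : (0 <= (discounted 0 r (passage l) w)%:E)%E by rewrite lee_fin discounted_ge0.
rewrite ge0_integralZl// in h; last by apply/measurable_EFinP; exact: mdisc.
have := congr1 (fun x => (expR (lambda * l))%:E * x)%E h.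
by rewrite mule1 muleA -EFinM -expRD subrr expR0 mul1e.
Qed.

Lemma discounted1_passage l : l < 0 ->
  (\int[P]_w (discounted 1 r (passage l) w)%:E = (expR l * expR (lambda * l))%:E)%E.
Proof.
move=> l0; have op := optional_passage l.
rewrite EFinM -(discounted0_passage l0) -ge0_integralZl//; last 2 first.
- by apply/measurable_EFinP; exact: mdisc.
- by move=> w _; rewrite lee_fin discounted_ge0.
apply: eq_integral => w _; rewrite -EFinM /discounted.
case tE: (passage l w) => [t| |]; rewrite ?mulr0//.
by rewrite (passage_level (ltW l0) tE) mul0r sub0r -expRD mul1r.
Qed.

Lemma le_discounted0 tau tau' w : (0 <= tau w)%E -> (tau w <= tau' w)%E ->
  discounted 0 r tau' w <= discounted 0 r tau w.
Proof.
rewrite /discounted.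
case: (tau w) (tau' w) => [t| |]// [t'| |]//= t0; rewrite ?expR_ge0//.
by rewrite lee_fin ler_expR !mul0r !sub0r lerN2 ler_pM2l.
Qed.

Lemma discounted0_inj tau tau' w : (0 <= tau w)%E -> (0 <= tau' w)%E ->
  discounted 0 r tau w = discounted 0 r tau' w -> tau w = tau' w.
Proof.
have e0 x : expR x = 0 -> False by move=> /eqP; rewrite gt_eqF// expR_gt0.
rewrite /discounted.
case: (tau w) (tau' w) => [t| |]// [t'| |]//= _ _.
- by move=> /expR_inj; rewrite !mul0r !sub0r => /oppr_inj/mulfI -> //; rewrite gt_eqF.
- by move=> /e0.
- by move=> /esym/e0.
Qed.

Lemma hitting_below_ge0 l w : (0 <= hitting_below Y l w)%E.
Proof. by apply: le_ereal_inf_tmp => _ [t [t0 _] <-]; rewrite lee_fin. Qed.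

(* [hitting_below Y l] lies between [passage l] and the passage times at levels decreasing
   to [l]; the explicit transforms [expR (lambda * _)] of these are continuous in the level. *)
Lemma hitting_below_passage l : l < 0 ->
  {ae P, forall w, passage l w = hitting_below Y l w}.
Proof.
move=> l0; pose D k := discounted 0 r (passage k).
pose D' := discounted 0 r (hitting_below Y l).
pose ln n : R := l - l * harmonic n.+1.
have ln0 n : ln n < 0.
  rewrite /ln /harmonic/= -{1}(mulr1 l) -mulrBr nmulr_rlt0// subr_gt0 invf_lt1 ?ltr0n//.
  by rewrite ltr1n.
have lln n : l < ln n by rewrite /ln ltrDl oppr_gt0 nmulr_rlt0// invr_gt0 ltr0n.
have hp w : (hitting_below Y l w <= passage l w)%E.
  apply: le_ereal_inf; apply: image_subset => t [t0 /ltW]; by split.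
have ph n w : (passage (ln n) w <= hitting_below Y l w)%E.
  apply: le_ereal_inf; apply: image_subset => t [t0 h]; split => //.
  exact: le_lt_trans h (lln n).
have mD k : measurable_fun setT (D k) by apply: mdisc; exact: optional_passage.
have : {ae P, forall w, D' w - D l w = 0}.
  apply: (@ae0_dominated _ _ _ P _ (fun n w => D (ln n) w - D l w)
      (fun n => expR (lambda * ln n) - expR (lambda * l))).
  - move=> n w; rewrite subr_ge0 lerD2r; apply/andP; split.
      by apply: le_discounted0 (hp w); exact: hitting_below_ge0.
    by apply: le_discounted0 (ph n w); exact: passage_ge0.
  - by move=> n; apply: measurable_funB.
  - move=> n; under eq_integral do rewrite EFinB.
    have iD k : k < 0 -> P.-integrable setT (fun w => (D k w)%:E).
      move=> k0; apply/integrableP; split; first exact/measurable_EFinP.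
      under eq_integral do rewrite gee0_abs ?lee_fin ?discounted_ge0//.
      by rewrite discounted0_passage// ltry.
    rewrite integralB//; [|exact: iD|exact: iD].
    by rewrite !discounted0_passage// EFinB.
  - rewrite -(subrr (expR (lambda * l))); apply: cvgB; last exact: cvg_cst.
    apply: (@continuous_cvg _ _ _ _ _ _ (fun x => expR (lambda * x))).
      by apply: continuous_comp; [exact: mulrl_continuous|exact: continuous_expR].
    rewrite -[X in _ --> X]subr0 -[X in _ - X](mulr0 l).
    apply: cvgB; first exact: cvg_cst.
    apply: cvgM; first exact: cvg_cst.
    by rewrite (cvg_shiftS (@harmonic R)); exact: cvg_harmonic.
apply: filterS => w /subr0_eq/esym/discounted0_inj; apply.
  exact: passage_ge0.
exact: hitting_below_ge0.
Qed.

Lemma optional_hitting_below l : l < 0 -> optional_time (hitting_below Y l).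
Proof.
move=> l0; apply: (optional_time_ae _ (hitting_below_passage l0)).
  exact: hitting_below_ge0.
exact: optional_passage.
Qed.

Lemma discounted_hitting_below l : l < 0 ->
  (\int[P]_w (discounted 0 r (hitting_below Y l) w)%:E = (expR (lambda * l))%:E)%E /\
  (\int[P]_w (discounted 1 r (hitting_below Y l) w)%:E =
    (expR l * expR (lambda * l))%:E)%E.
Proof.
move=> l0; rewrite -(discounted0_passage l0) -(discounted1_passage l0).
by split; apply/esym/discounted_ae; [exact: hitting_below_passage|exact: optional_passage
  |exact: optional_hitting_below|exact: hitting_below_passage|exact: optional_passage
  |exact: optional_hitting_below].
Qed.

(* Integrates the pointwise bound at time [tau], using that the discounted exponentials
   have expectation at most 1; equality forces the slack to vanish a.s. on [tau < +oo]. *)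
Lemma discounted_bound (K b A C : R) tau : 0 <= K -> 0 <= b -> 0 <= A -> 0 <= C ->
  optional_time tau -> (forall y, K - b * expR y <= A + C * expR (- lambda * y)) ->
  exists D0 D1 : R, [/\ (\int[P]_w (discounted 0 r tau w)%:E = D0%:E)%E,
    (\int[P]_w (discounted 1 r tau w)%:E = D1%:E)%E,
    K * D0 - b * D1 <= A + C &
    K * D0 - b * D1 = A + C -> {ae P, forall w, forall t, tau w = t%:E ->
      K - b * expR (Y t w) = A + C * expR (- lambda * Y t w)}].
Proof.
move=> K0 b0 A0 C0 otau bnd; have [tau0 _] := otau.
pose D th w := discounted th r tau w.
have mD th : measurable_fun setT (D th) by exact: mdisc.
have D_ge0 th w : 0 <= D th w by exact: discounted_ge0.
have le1 th p : th < eta -> 1 < p -> p * th < eta -> psi th <= r ->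
    (\int[P]_w (D th w)%:E <= 1)%E.
  move=> the p1 pthe psir.
  apply: le_trans (discounted_le1 mY rcY Y0 sG ndG mG martY the p1 pthe otau).
  apply: ge0_le_integral => //.
  - by move=> w _; rewrite lee_fin.
  - exact/measurable_EFinP.
  - by apply/measurable_EFinP; exact: mdisc.
  - move=> w _; rewrite lee_fin /D /discounted.
    move: (tau0 w); case: (tau w) => [t| |]//; rewrite lee_fin => t0.
    by rewrite ler_expR lerD2l lerN2 ler_wpM2r.
have D3le : (\int[P]_w (D (- lambda) w)%:E <= 1)%E.
  by apply: (@le1 _ 2); rewrite ?psi_lambda ?ltr1n.
have D1le : (\int[P]_w (D 1 w)%:E <= 1)%E.
  have p1 : 1 < (1 + eta) / 2 by move: eta_gt1; lra.
  have pe : (1 + eta) / 2 * 1 < eta by move: eta_gt1; lra.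
  exact: (le1 _ _ eta_gt1 p1 pe (ltW psi_lt)).
have D0le : (\int[P]_w (D 0 w)%:E <= 1)%E.
  apply: (@le_trans _ _ (\int[P]_w 1%:E)%E); last first.
    by rewrite integral_cst//= mul1e probability_setT.
  apply: ge0_le_integral => //.
  - by move=> w _; rewrite lee_fin.
  - exact/measurable_EFinP.
  - move=> w _; rewrite lee_fin /D /discounted.
    move: (tau0 w); case: (tau w) => [t| |]//; rewrite lee_fin => t0.
    by rewrite -expR0 ler_expR mul0r sub0r oppr_le0 mulr_ge0// ltW.
have fin th : (\int[P]_w (D th w)%:E <= 1)%E ->
    exists x : R, (\int[P]_w (D th w)%:E = x%:E)%E /\ x <= 1.
  have : (0 <= \int[P]_w (D th w)%:E)%E by apply: integral_ge0 => w _; rewrite lee_fin.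
  by case: (\int[P]_w _)%E => [x| |]// _ x1; exists x.
have [D0 [D0E D01]] := fin _ D0le; have [D1 [D1E D11]] := fin _ D1le.
have [D3 [D3E D31]] := fin _ D3le.
exists D0, D1; rewrite -/(D _).
pose f w := A * D 0 w + C * D (- lambda) w - (K * D 0 w - b * D 1 w).
have fE w t : tau w = t%:E ->
    f w = expR (- (r * t)) * (A + C * expR (- lambda * Y t w) - (K - b * expR (Y t w))).
  move=> tE; rewrite /f /D /discounted tE mul0r sub0r mul1r !expRD; ring.
have f0 w : 0 <= f w.
  move: (tau0 w); case tE : (tau w) => [t| |]// _.
    by rewrite (fE _ t)// mulr_ge0 ?expR_ge0// subr_ge0.
  by rewrite /f /D /discounted tE !mulr0 !subr0 addr0.
have iD th x : (\int[P]_w (D th w)%:E = x%:E)%E -> P.-integrable setT (fun w => (D th w)%:E).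
  move=> Dx; apply/integrableP; split; first exact/measurable_EFinP.
  under eq_integral do rewrite gee0_abs ?lee_fin//.
  by rewrite Dx ltry.
have i0 := iD _ _ D0E; have i1 := iD _ _ D1E; have i3 := iD _ _ D3E.
have mf : measurable_fun setT f.
  by apply: measurable_funB; [apply: measurable_funD|apply: measurable_funB];
    exact: measurable_funM.
have intf : (\int[P]_w (f w)%:E = (A * D0 + C * D3 - (K * D0 - b * D1))%:E)%E.
  have iZ k th x : (\int[P]_w (D th w)%:E = x%:E)%E ->
      P.-integrable setT (fun w => (k * D th w)%:E) /\
      (\int[P]_w (k * D th w)%:E = (k * x)%:E)%E.
    move=> Dx; have iDx := iD _ _ Dx.
    rewrite (_ : (fun w => (k * D th w)%:E) = (fun w => k%:E * (D th w)%:E)%E)//.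
    by split; [exact: integrableZl|rewrite integralZl// Dx].
  have [iA IA] := iZ A _ _ D0E; have [iC IC] := iZ C _ _ D3E.
  have [iK IK] := iZ K _ _ D0E; have [ib Ib] := iZ b _ _ D1E.
  under eq_integral do rewrite EFinB EFinD EFinB.
  rewrite integralB//; [|exact: integrableD|exact: integrableB].
  by rewrite integralD// integralB// IA IC IK Ib.
have int0 : (0 <= \int[P]_w (f w)%:E)%E by apply: integral_ge0 => w _; rewrite lee_fin.
have ACle : A * D0 + C * D3 <= A + C by rewrite lerD// ler_piMr.
rewrite intf lee_fin in int0; split => //; first lra.
move=> opt; have : {ae P, forall w, f w = 0}.
  apply: ae0_integral_le0 => //; rewrite intf lee_fin; lra.
apply: filterS => w + t tE; rewrite (fE _ t)// => /eqP.
by rewrite mulf_eq0 gt_eqF ?expR_gt0//= subr_eq0 => /eqP.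
Qed.

End passage_times.

(** * Verification *)

(* Tangent lines at [y = l]: the left side is the (scaled) payoff of stopping at level
   [expR y], the right side the power function through which it is dominated. *)
Lemma expR_threshold {R : realType} (lambda l y : R) : 0 < lambda ->
  lambda + 1 - lambda * expR (- l) * expR y <= expR (lambda * l) * expR (- lambda * y).
Proof.
move=> lam0; rewrite -mulrA -!expRD.
rewrite (_ : lambda * l + - lambda * y = - lambda * (y - l)); last by ring.
rewrite (addrC (- l)).
have h1 := expR_ge1Dx (y - l); have h2 := expR_ge1Dx (- lambda * (y - l)); nra.
Qed.

Lemma expR_threshold_eq {R : realType} (lambda l y : R) : 0 < lambda ->
  lambda + 1 - lambda * expR (- l) * expR y = expR (lambda * l) * expR (- lambda * y) ->
  y = l.
Proof.
move=> lam0; rewrite -mulrA -!expRD.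
rewrite (_ : lambda * l + - lambda * y = - lambda * (y - l)); last by ring.
rewrite (addrC (- l)) => E; apply/eqP; rewrite -subr_eq0; apply/negPn/negP => yl.
have h1 := expR_gt1Dx yl; have h2 := expR_ge1Dx (- lambda * (y - l)); nra.
Qed.

Lemma laplace_exponent1 {R : realType} (m sigma a eta : R) :
  laplace_exponent m sigma a eta 1 = psi1 m sigma a eta.
Proof. by rewrite /laplace_exponent /psi1 !mulr1 expr1n mulr1. Qed.

Lemma laplace_exponent_root {R : realType} (m sigma a eta r lambda : R) :
  0 < eta -> 0 < lambda ->
  r%:C%C + Psi m sigma a eta ('i%C * lambda%:C%C) = 0 ->
  laplace_exponent m sigma a eta (- lambda) = r.
Proof.
move=> eta0 lam0; rewrite /Psi.
have ii (z : R[i]) : 'i%C * ('i%C * z) = - z by rewrite mulrA -expr2 sqr_i mulN1r.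
have e1 (x y : R[i]) : - 'i%C * x * ('i%C * y) = x * y.
  by transitivity (- ('i%C * ('i%C * (x * y)))); [ring|rewrite ii opprK].
have e2 (x y : R[i]) : x * 'i%C * ('i%C * y) = - (x * y).
  by transitivity ('i%C * ('i%C * (x * y))); [ring|rewrite ii].
rewrite e1 e2 ii exprMn sqr_i mulN1r opprK => E.
have {}E : r + (m * lambda + sigma ^+ 2 * - lambda ^+ 2 / 2 - - (a * lambda) / (eta + lambda)) = 0.
  apply: complexI; rewrite rmorph0 -E.
  by rewrite !(rmorphD, rmorphN, rmorphM, rmorphXn, fmorphV, rmorph_nat).
move/eqP: E; rewrite addr_eq0 => /eqP ->; rewrite /laplace_exponent opprK; ring.
Qed.

Section optimality.
Context {d : measure_display} {T : measurableType d} {R : realType}.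
Variable P : probability T R.
Hypothesis P_complete : measure_is_complete P.

Lemma probability_ae1 (A : set T) : {ae P, forall w, A w} -> P A = 1%E.
Proof.
move=> aeA; have mA : measurable (~` A) by apply: P_complete; exact: aeA.
have PA : P (~` A) = 0%E by apply/negligibleP.
by rewrite -[A]setCK probability_setC// PA sube0.
Qed.

Lemma smallest_optimal_bound (r alpha c g : R) (V : R -> T -> R) tau :
  stopping_time (usual_filtration P V) tau -> expected_gain P r alpha c V tau = g%:E ->
  (forall tau', stopping_time (usual_filtration P V) tau' ->
    (expected_gain P r alpha c V tau' <= g%:E)%E /\
    (expected_gain P r alpha c V tau' = g%:E -> {ae P, forall w, (tau w <= tau' w)%E})) ->
  optimal_value P r alpha c V = g%:E /\ smallest_optimal P r alpha c V tau.
Proof.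
move=> stau gtau bnd.
have ov : optimal_value P r alpha c V = g%:E.
  apply/eqP; rewrite eq_le; apply/andP; split.
    by apply: ge_ereal_sup => _ [tau' stau' <-]; have [] := bnd _ stau'.
  by apply: ereal_sup_ubound; exists tau.
split => //; split; first by split => //; rewrite ov.
move=> tau' [stau' gtau']; apply: probability_ae1.
by have [_] := bnd _ stau'; apply; rewrite gtau'.
Qed.

End optimality.

Section verification.
Context {d : measure_display} {T : measurableType d} {R : realType}.
Variable P : probability T R.
Variables (W : R -> {RV P >-> R}) (N : R -> {RV P >-> nat}) (U : nat -> {RV P >-> R}).
Variables (m sigma a eta r alpha c lambda : R).
Hypotheses (a_gt0 : 0 < a) (eta_gt1 : 1 < eta).
Hypotheses (r_gt0 : 0 < r) (alpha_gt0 : 0 < alpha) (c_gt0 : 0 < c).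
Hypothesis P_complete : measure_is_complete P.
Hypothesis W_brownian : brownian_motion W.
Hypothesis N_poisson : poisson_process a N.
Hypothesis U_exponential : iid_exponential eta U.
Hypothesis WNU_independent : independent_WNU W N U.
Hypothesis r_gt_psi1 : psi1 m sigma a eta < r.
Hypothesis lambda_gt0 : 0 < lambda.
Hypothesis lambda_root : laplace_exponent m sigma a eta (- lambda) = r.
Variable v : R.
Hypothesis v_gt0 : 0 < v.

Notation X := (jump_diffusion m sigma W N U).
Notation V := (exp_process X v).
Notation Y := (path_version W N U m sigma).
Notation B := (B_c m sigma a eta r alpha c lambda).
Notation F := (usual_filtration P V).
Notation psi := (laplace_exponent m sigma a eta).
Let G := augmented_filtration W N U m sigma v.

Let eta_gt0 : 0 < eta. Proof. exact: lt_trans ltr01 eta_gt1. Qed.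
Let psi_lt : psi 1 < r. Proof. by rewrite laplace_exponent1. Qed.

Let mY := measurable_path_version m sigma P_complete W_brownian N_poisson U_exponential.
Let upY := upward_jumping_path_version W N U m sigma.
Let sG t : sigma_algebra setT (G t).
Proof. exact: augmented_filtration_sigma_algebra. Qed.

Let ndG s t : s <= t -> G s `<=` G t.
Proof. exact: augmented_filtration_le. Qed.

Let mG t : G t `<=` measurable.
Proof. exact: (measurable_augmented_filtration P_complete N_poisson). Qed.

Let eqG t A A' : {ae P, forall w, A w <-> A' w} -> G t A -> G t A'.
Proof. exact: augmented_filtration_eq. Qed.

Let YG l q t : 0 <= q -> q <= t -> G t [set w | Y q w < l].
Proof. exact: (augmented_filtration_path W_brownian N_poisson U_exponential l v_gt0). Qed.

Let martY := path_version_martingale a_gt0 eta_gt0 P_complete W_brownian N_poisson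
  U_exponential WNU_independent (m := m) (sigma := sigma) (v := v).

Let V_ae : {ae P, forall w t, V t w = v * expR (Y t w)}.
Proof.
apply: filterS (path_version_ae m sigma W_brownian N_poisson U_exponential) => w YX t.
by rewrite /exp_process YX.
Qed.

Let B_gt0 : 0 < B.
Proof.
by rewrite /B_c divr_gt0// ?mulr_gt0// ?subr_gt0// ?addr_gt0.
Qed.

Let l := ln (B / v).
Let lB : expR l = B / v.
Proof. by rewrite lnK// posrE divr_gt0. Qed.

Let vB : expR (- l) = v / B.
Proof. by rewrite expRN lB invf_div. Qed.

Let q := r - psi1 m sigma a eta.
Let q_gt0 : 0 < q. Proof. by rewrite subr_gt0. Qed.

Let hitting_ae : {ae P, forall w, hitting_below Y l w = hitting_below V B w}.
Proof.
apply: filterS V_ae => w VY; congr ereal_inf; congr image.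
apply/seteqP; split => t /= [t0]; rewrite VY => h; split => //.
  by rewrite -ler_pdivlMl// mulrC -lB ler_expR.
by rewrite -ler_expR lB mulrC ler_pdivlMl.
Qed.

Let gainE tau D0 D1 : optional_time G tau ->
  (\int[P]_w (discounted Y 0 r tau w)%:E = D0%:E)%E ->
  (\int[P]_w (discounted Y 1 r tau w)%:E = D1%:E)%E ->
  expected_gain P r alpha c V tau =
    (alpha * v / q - c / r + (c / r * D0 - alpha * v / q * D1))%:E.
Proof.
move=> otau D0E D1E.
have p1 : 1 < (1 + eta) / 2 by move: eta_gt1; lra.
have pe : (1 + eta) / 2 < eta by move: eta_gt1; lra.
rewrite (expected_gainE mY _ _ sG ndG mG martY alpha c P_complete V_ae r_gt0 eta_gt1 p1 pe
  psi_lt otau D0E D1E).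
- by rewrite laplace_exponent1 -/q; congr EFin; ring.
- by move=> t w t0; have [_ + _] := upY w; exact.
- by move=> w; have [] := upY w.
Qed.

Let stopping_below_threshold tau : optional_time G tau ->
  {ae P, forall w, tau w = hitting_below V B w} ->
  optional_time G (hitting_below V B) /\ stopping_time F (hitting_below V B).
Proof.
move=> otau tt.
have oB := optional_time_ae eqG (hitting_below_ge0 V B) tt otau.
by split => //; exact: stopping_time_optional.
Qed.

Let threshold_coef : alpha * v / q = c / r / (lambda + 1) * lambda * (v / B).
Proof.
rewrite /B_c -/q; field.
rewrite !gt_eqF// ?addr_gt0//.
Qed.

Lemma smallest_optimal_above : B < v ->
  optimal_value P r alpha c V =
    (alpha * v / q - c / r + c / (r * (1 + lambda)) * (B / v) `^ lambda)%:E /\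
  smallest_optimal P r alpha c V (hitting_below V B).
Proof.
move=> Bv; have l0 : l < 0 by rewrite ln_lt0// divr_gt0//= ltr_pdivrMr// mul1r.
have oY := optional_hitting_below mY upY sG ndG mG eqG YG martY eta_gt1 lambda_gt0 r_gt0
  lambda_root l0.
have [oB sB] := stopping_below_threshold oY hitting_ae.
pose M := c / r / (lambda + 1).
have M0 : 0 < M by rewrite !divr_gt0// addr_gt0.
have valE : c / (r * (1 + lambda)) * (B / v) `^ lambda = M * expR (lambda * l).
  have -> : (B / v) `^ lambda = expR (lambda * l) by rewrite /powR gt_eqF// divr_gt0.
  by rewrite /M invfM mulrA (addrC 1).
have Mc : M * (lambda + 1) = c / r by rewrite /M divfK// gt_eqF// addr_gt0.
have bE : alpha * v / q = M * lambda * expR (- l) by rewrite vB threshold_coef.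
clearbody M.
have expl : expR (- l) * expR l = 1 by rewrite -expRD addNr expR0.
rewrite valE; apply: smallest_optimal_bound => //.
  have [D0E D1E] := discounted_hitting_below mY upY sG ndG mG eqG YG martY eta_gt1
    lambda_gt0 r_gt0 lambda_root l0.
  rewrite (discounted_ae mY upY mG _ _ hitting_ae oY oB) in D0E.
  rewrite (discounted_ae mY upY mG _ _ hitting_ae oY oB) in D1E.
  rewrite (gainE oB D0E D1E); congr (_ + _)%:E.
  rewrite -Mc bE; move: expl; move: (expR (- l)) (expR l) (expR _) => x y z xy.
  rewrite mulrA -(mulrA (M * lambda)) xy; ring.
move=> tau' stau'; have otau' := optional_stopping_time stau'; have [tau0 _] := stau'.
have c0 : 0 <= c / r by rewrite divr_ge0// ltW.
have b0 : 0 <= alpha * v / q by rewrite divr_ge0 ?mulr_ge0// ltW.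
have C0 : 0 <= M * expR (lambda * l) by rewrite mulr_ge0 ?expR_ge0// ltW.
have [|D0 [D1 [D0E D1E le eq]]] := discounted_bound mY upY sG ndG mG martY eta_gt1 lambda_gt0
    r_gt0 lambda_root psi_lt c0 b0 (lexx 0) C0 otau'.
  move=> y; rewrite add0r -Mc bE -!mulrA -mulrBr ler_pM2l// mulrA.
  exact: expR_threshold.
rewrite (gainE otau' D0E D1E); split; first by rewrite lee_fin lerD2l -[leRHS]add0r.
move=> -[/addrI E].
have := eq; rewrite add0r E => /(_ erefl).
apply: filterS2 hitting_ae => w <- h.
move: (tau0 w) (h); case tE : (tau' w) => [t| |]// t0; last by rewrite leey.
move=> /(_ t erefl); rewrite add0r -Mc bE -!mulrA -mulrBr => /(mulfI (lt0r_neq0 M0)).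
rewrite mulrA => /(expR_threshold_eq lambda_gt0) Yl.
by apply: ereal_inf_lbound; exists t => //; split; [rewrite -lee_fin|rewrite Yl].
Qed.

Lemma smallest_optimal_below : v <= B ->
  smallest_optimal P r alpha c V (hitting_below V B).
Proof.
move=> vB'.
have h0 : {ae P, forall w, cst 0%E w = hitting_below V B w}.
  apply: filterS V_ae => w VY; apply/eqP; rewrite eq_le hitting_below_ge0/=.
  apply: ereal_inf_lbound; exists 0 => //; split => //.
  by rewrite VY; have [-> _ _] := upY w; rewrite expR0 mulr1.
have o0 := optional_time_cst0 sG.
have [oB sB] := stopping_below_threshold o0 h0.
have D0E th : (\int[P]_w (discounted Y th r (hitting_below V B) w)%:E = 1%:E)%E.
  rewrite -(discounted_ae mY upY mG _ _ h0 o0 oB).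
  rewrite (eq_integral (fun=> 1%E)) => [|w _].
    by rewrite integral_cst//= mul1e probability_setT.
  by rewrite /discounted/=; have [-> _ _] := upY w; rewrite !mulr0 subrr expR0.
have gB : expected_gain P r alpha c V (hitting_below V B) = 0%:E.
  by rewrite (gainE oB (D0E 0) (D0E 1)); congr EFin; ring.
apply: (proj2 (smallest_optimal_bound P_complete sB gB _)).
move=> tau' stau'; have otau' := optional_stopping_time stau'; have [tau0 _] := stau'.
split; last first.
  by move=> _; apply: filterS h0 => w /= <-.
pose M := alpha * v / q / lambda.
have c0 : 0 <= c / r by rewrite divr_ge0// ltW.
have b0 : 0 <= alpha * v / q by rewrite divr_ge0 ?mulr_ge0// ltW.
have M0 : 0 <= M by rewrite /M divr_ge0// ltW.
have bE : alpha * v / q = M * lambda by rewrite /M divfK// gt_eqF.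
have A0 : 0 <= c / r - M * (lambda + 1).
  rewrite /M threshold_coef subr_ge0.
  rewrite (_ : _ / lambda * _ = c / r * (v / B)); last first.
    by field; rewrite !gt_eqF// ?addr_gt0.
  by rewrite ler_piMr// ler_pdivrMr// mul1r.
have [|D0 [D1 [D0'E D1'E le _]]] := discounted_bound mY upY sG ndG mG martY eta_gt1 lambda_gt0
    r_gt0 lambda_root psi_lt c0 b0 A0 M0 otau'.
  move=> y; rewrite bE -addrA lerD2l -lerBlDl opprK addrC.
  have := ler_wpM2l M0 (@expR_threshold _ lambda 0 y lambda_gt0).
  by rewrite mulr0 oppr0 expR0 mulr1 mul1r mulrBr mulrA.
rewrite (gainE otau' D0'E D1'E) lee_fin; move: le; rewrite bE; lra.
Qed.

End verification.

Theorem proposition4p7 (d : measure_display) (T : measurableType d)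
    (R : realType) (P : probability T R)
    (W : R -> {RV P >-> R}) (N : R -> {RV P >-> nat}) (U : nat -> {RV P >-> R})
    (m sigma a eta1 r alpha c lambda : R)
    (sigma_gt0 : 0 < sigma) (a_gt0 : 0 < a) (eta1_gt1 : 1 < eta1)
    (r_gt0 : 0 < r) (alpha_gt0 : 0 < alpha) (c_gt0 : 0 < c)
    (P_complete : measure_is_complete P)
    (W_brownian : brownian_motion W)
    (N_poisson : poisson_process a N)
    (U_exponential : iid_exponential eta1 U)
    (WNU_independent : independent_WNU W N U)
    (r_gt_psi1 : psi1 m sigma a eta1 < r)
    (lambda_gt0 : 0 < lambda)
    (lambda_root : r%:C%C + Psi m sigma a eta1 ('i%C * lambda%:C%C) = 0) :
  let V := exp_process (jump_diffusion m sigma W N U) in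
  let B := B_c m sigma a eta1 r alpha c lambda in
  (forall v : R, 0 < v ->
    smallest_optimal P r alpha c (V v) (hitting_below (V v) B)) /\
  (forall v : R, 0 < v -> B < v ->
    optimal_value P r alpha c (V v) =
      (alpha * v / (r - psi1 m sigma a eta1) - c / r
       + c / (r * (1 + lambda)) * (B / v) `^ lambda)%:E).
Proof.
have root := laplace_exponent_root (lt_trans ltr01 eta1_gt1) lambda_gt0 lambda_root.
move=> V B; split => [v v0|v v0 Bv].
  have [vB|Bv] := leP v B; first exact: smallest_optimal_below root v v0 vB.
  by have [] := smallest_optimal_above a_gt0 eta1_gt1 r_gt0 alpha_gt0 c_gt0 P_complete
    W_brownian N_poisson U_exponential WNU_independent r_gt_psi1 lambda_gt0 root v0 Bv.
by have [] := smallest_optimal_above a_gt0 eta1_gt1 r_gt0 alpha_gt0 c_gt0 P_complete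
  W_brownian N_poisson U_exponential WNU_independent r_gt_psi1 lambda_gt0 root v0 Bv.
Qed.
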